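(* Let $\mathcal{E}=\{|\varphi_i\rangle,p_i\}_{i\in\mathcal I}$ be a finite ensemble of pure states on $\mathbb{C}^d$, and let $n\ge1$, $R\ge0$, $\epsilon>0$. Let $\Gamma$ be a CPTP map from operators on $(\mathbb{C}^d)^{\otimes n}$ (system $B$) to operators on $(\mathbb{C}^d)^{\otimes n}\otimes\mathcal H_C$ (system $BC$), where $\mathcal H_C$ is a classical register. That is, for each $I$, $\Gamma(\varphi_I)=\sum_jp(j|I)\,\tilde\varphi_{I,j}\otimes|j\rangle\langle j|$ for a fixed orthonormal basis $\{|j\rangle\}$ of $\mathcal H_C$. Suppose: 1. $H(I:j)\ge nR$, where $H(I:j)$ is the classical mutual information of the joint distribution $p_Ip(j|I)$. 2. The mean letterwise fidelity satisfies $\sum_Ip_I\frac1n\sum_{k=1}^nF\big(\varphi_{i_k},\mathrm{Tr}_{\neq k}\mathrm{Tr}_C\Gamma(\varphi_I)\big)\ge1-\epsilon$. Then $S(\mathcal{E})\ge X_\epsilon(\mathcal{E},R)$. Moreover, the Holevo quantity of the ensemble $\mathcal F^{BC}=\{\Gamma(\varphi_I),p_I\}_{I\in\mathcal I^n}$ satisfies $\chi(\mathcal F^{BC})\ge nX_\epsilon(\mathcal{E},R)$.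
   Context: Notation: - $\varphi_i=|\varphi_i\rangle\langle\varphi_i|$; $\varphi_I=\varphi_{i_1}\otimes\cdots\otimes\varphi_{i_n}$ and $p_I=\prod_kp_{i_k}$ for $I=i_1\dots i_n$. - $\mathrm{Tr}_{\neq k}$ traces out all tensor factors of $(\mathbb{C}^d)^{\otimes n}$ except the $k$-th. - $F(\psi,\sigma)=\mathrm{Tr}(\psi\sigma)$ for pure $\psi$. - $S(\mathcal{E})=S(\sum_ip_i\varphi_i)$, with von Neumann entropy in base 2. - The Holevo quantity is $\chi(\{\rho_x,s_x\})=S(\sum_xs_x\rho_x)-\sum_xs_xS(\rho_x)$. $X_\epsilon(\mathcal{E},R)=R+M_\epsilon(\mathcal{E},R)$, where $M_\epsilon$ is defined as follows. - An encoding map $E$ assigns to each $i\in\mathcal I$ a state $E(i)=\sum_jp(j|i)\,\omega_{i,j}\otimes|j\rangle\langle j|$ on $\mathcal H_{B'}\otimes\mathcal H_{C'}$ (finite-dimensional, $\{|j\rangle\}$ orthonormal). - With $\rho^{ABC}=\sum_ip_i|i\rangle\langle i|\otimes E(i)$, let $S(A:C)=S(A)+S(C)-S(AC)$ and $S(A:B|C)=S(AC)+S(BC)-S(ABC)-S(C)$. - $T_\epsilon(\mathcal{E},R)$ is the set of encoding maps with $S(A:C)\le R$ for which some CPTP $D$ into operators on $\mathbb{C}^d$ satisfies $\sum_ip_i\langle\varphi_i|D(E(i))|\varphi_i\rangle\ge1-\epsilon$. - $M_\epsilon(\mathcal{E},R)=\inf\{S(A:B|C):E\in T_\epsilon(\mathcal{E},R)\}$.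 *)

(* Defs.v *)
From HB Require Import structures.
From mathcomp Require Import all_boot all_order all_algebra.
From mathcomp Require Import all_classical all_reals all_analysis.
From mathcomp.real_closed Require Import complex.
Set Implicit Arguments. Unset Strict Implicit. Unset Printing Implicit Defensive.
Import Order.TTheory GRing.Theory Num.Theory.
Local Open Scope ring_scope.

Section QuantumDefs.
Variable R : realType.
Local Notation C := R[i].

Definition toC (x : R) : C := real_complex R x.

(* Operators on the Hilbert space C^T with orthonormal basis indexed by the
   finite type T; stored as #|T| x #|T| matrices (via enum_rank). *)
Definition op (T : finType) := 'M[C]_#|T|.
Definition ent (T : finType) (A : op T) (x y : T) : C :=
  A (enum_rank x) (enum_rank y).
Definition mkop (T : finType) (f : T -> T -> C) : op T :=
  \matrix_(i, j) f (enum_val i) (enum_val j).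

Definition adj (m n : nat) (A : 'M[C]_(m, n)) : 'M[C]_(n, m) :=
  (map_mx Num.conj A)^T.
Definition psd (n : nat) (A : 'M[C]_n) : Prop :=
  forall v : 'cV[C]_n, 0 <= (adj v *m A *m v) 0 0.
Definition density (n : nat) (A : 'M[C]_n) : Prop := psd A /\ \tr A = 1.

Definition unit_ket (T : finType) (psi : T -> C) : Prop :=
  \sum_x `|psi x| ^+ 2 = 1.
Definition ket_proj (T : finType) (psi : T -> C) : op T :=
  mkop (fun x y => psi x * Num.conj (psi y)).
Definition basis_ket (T : finType) (t : T) : T -> C := fun x => (x == t)%:R.

Definition tens (S T : finType) (A : op S) (B : op T) : op (S * T)%type :=
  mkop (fun x y => ent A x.1 y.1 * ent B x.2 y.2).
Definition ptr2 (S T : finType) (A : op (S * T)%type) : op S :=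
  mkop (fun x y => \sum_t ent A (x, t) (y, t)).
Definition ptr1 (S T : finType) (A : op (S * T)%type) : op T :=
  mkop (fun x y => \sum_s ent A (s, x) (s, y)).
(* Tr_{\neq k} on (C^T)^{\otimes n}, index type {ffun 'I_n -> T} *)
Definition ptr_except (n : nat) (T : finType) (k : 'I_n)
    (A : op {ffun 'I_n -> T}) : op T :=
  mkop (fun a b => \sum_(x : {ffun 'I_n -> T} | x k == a)
                     ent A x (finfun (fun l => if l == k then b else x l))).

Definition linear_map (S T : finType) (Phi : op S -> op T) : Prop :=
  forall (a : C) (A B : op S), Phi (a *: A + B) = a *: Phi A + Phi B.
(* complete positivity: id_m (x) Phi is positive for every m *)
Definition cp_map (S T : finType) (Phi : op S -> op T) : Prop :=
  forall (m : nat) (X : op ('I_m * S)%type), psd X ->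
    psd (mkop (fun p q : ('I_m * T)%type =>
      ent (Phi (mkop (fun s s' => ent X (p.1, s) (q.1, s')))) p.2 q.2)).
Definition tp_map (S T : finType) (Phi : op S -> op T) : Prop :=
  forall A, \tr (Phi A) = \tr A.
Definition cptp (S T : finType) (Phi : op S -> op T) : Prop :=
  [/\ linear_map Phi, cp_map Phi & tp_map Phi].

Definition log2 (x : R) : R := ln x / ln 2.
Definition eta (x : R) : R := if x == 0 then 0 else - (x * log2 x).
Definition vN_entropy (n : nat) (A : 'M[C]_n) : R :=
  \sum_i eta (complex.Re (spectral_diag A 0 i)).
Definition shannon (T : finType) (q : T -> R) : R := \sum_x eta (q x).
Definition mutual_info (S T : finType) (q : S * T -> R) : R :=
  shannon (fun s => \sum_t q (s, t)) + shannon (fun t => \sum_s q (s, t))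
  - shannon q.

(* fidelity F(psi, sigma) = Tr(|psi><psi| sigma) (real part; it is real for
   Hermitian sigma) *)
Definition fid (T : finType) (psi : T -> C) (sigma : op T) : R :=
  complex.Re (\tr (ket_proj psi *m sigma)).

Definition holevo (J T : finType) (s : J -> R) (rho : J -> op T) : R :=
  vN_entropy (\sum_j toC (s j) *: rho j) - \sum_j s j * vN_entropy (rho j).

Section Ensemble.
Variables (I : finType) (d : nat) (p : I -> R) (phi : I -> 'I_d -> C).

Definition ens_state : op 'I_d := \sum_i toC (p i) *: ket_proj (phi i).
Definition ens_entropy : R := vN_entropy ens_state.

Definition prob_seq (n : nat) (II : {ffun 'I_n -> I}) : R := \prod_k p (II k).
Definition prod_state (n : nat) (II : {ffun 'I_n -> I}) : op {ffun 'I_n -> 'I_d} :=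
  ket_proj (fun x : {ffun 'I_n -> 'I_d} => \prod_k phi (II k) (x k)).

(* encoding maps E(i) = sum_j p(j|i) omega_{i,j} (x) |j><j| on C^b (x) C^c *)
Record encoding := Encoding {
  enc_b : nat;
  enc_c : nat;
  enc_p : I -> 'I_enc_c -> R;
  enc_om : I -> 'I_enc_c -> op 'I_enc_b }.
Arguments enc_p : clear implicits.
Arguments enc_om : clear implicits.

Definition valid_encoding (E : encoding) : Prop :=
  forall i, [/\ forall j, 0 <= enc_p E i j, \sum_j enc_p E i j = 1
              & forall j, density (enc_om E i j)].

Definition enc_state (E : encoding) (i : I) : op ('I_(enc_b E) * 'I_(enc_c E))%type :=
  \sum_j toC (enc_p E i j) *: tens (enc_om E i j) (ket_proj (basis_ket j)).

Definition rhoABC (E : encoding) : op (I * ('I_(enc_b E) * 'I_(enc_c E)))%type :=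
  \sum_i toC (p i) *: tens (ket_proj (basis_ket i)) (enc_state E i).
Definition rhoA E : op I := ptr2 (rhoABC E).
Definition rhoBC E : op ('I_(enc_b E) * 'I_(enc_c E))%type := ptr1 (rhoABC E).
Definition rhoC E : op 'I_(enc_c E) := ptr1 (rhoBC E).
Definition rhoAC E : op (I * 'I_(enc_c E))%type :=
  mkop (fun x y => \sum_b ent (rhoABC E) (x.1, (b, x.2)) (y.1, (b, y.2))).

Definition SAC (E : encoding) : R :=
  vN_entropy (rhoA E) + vN_entropy (rhoC E) - vN_entropy (rhoAC E).
Definition SABgC (E : encoding) : R :=
  vN_entropy (rhoAC E) + vN_entropy (rhoBC E) - vN_entropy (rhoABC E)
  - vN_entropy (rhoC E).

Definition T_eps (eps rate : R) : set encoding :=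
  [set E | [/\ valid_encoding E, SAC E <= rate &
     exists D : op ('I_(enc_b E) * 'I_(enc_c E))%type -> op 'I_d,
       cptp D /\ 1 - eps <= \sum_i p i * fid (phi i) (D (enc_state E i))]].

(* M_eps(E,R) = inf (in the extended reals; inf of the empty set is +oo) *)
Definition M_eps (eps rate : R) : \bar R :=
  ereal_inf [set (SABgC E)%:E | E in T_eps eps rate].
Definition X_eps (eps rate : R) : \bar R := (rate%:E + M_eps eps rate)%E.

End Ensemble.
End QuantumDefs.
Arguments basis_ket {R T}.

(* Main.v *)
(* Reveal one letter of the sequence at a time: by the chain rule the information
   that [BC] carries about [A_1 ... A_n] is the sum over [k] of the information
   about [A_k] carried by [BC] together with the earlier letters.  Choosing [k]
   uniformly and putting [k], the earlier letters and [j] in the classical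
   register gives a one-letter encoding whose total information is [chi / n],
   whose classical information is [H(I:j) / n >= R], and whose mean fidelity is the
   letterwise fidelity of [Gamma].  Erasing the classical register with a suitable
   probability, while a copy of it is kept in the quantum register, lowers the
   classical information to exactly [R] at constant total information, so
   [X_eps(R) <= chi / n].

   The bound [chi <= n S(E)] is monotonicity of the Holevo quantity under [Gamma],
   that is, of relative entropy.  Riemann sums write the logarithm as a limit of
   combinations of [x |-> 1 / (x + t)]; for these the relative entropy becomes
   [sum_ij |<i|j>|^2 r_i^2 / (q_j + t r_i)], a supremum over [X] of
   [2 Re tr(rho X) - tr(sigma X^* X) - t tr(rho X X^* )], which decreases under a
   channel by the Kadison-Schwarz inequality for its dual. *)
Require Import Defs.
From HB Require Import structures.
From mathcomp Require Import all_boot all_order all_algebra.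
From mathcomp Require Import all_classical all_reals all_analysis.
From mathcomp.real_closed Require Import complex.
From mathcomp Require Import spectral ring lra.
Import Order.TTheory GRing.Theory Num.Theory.
Local Open Scope ring_scope.
Set Implicit Arguments.
Unset Strict Implicit.
Unset Printing Implicit Defensive.

HB.instance Definition _ (R : realType) := GRing.RMorphism.copy (@toC R) (real_complex R).

(** * Entrywise calculus of operators and positivity *)

Section Operators.
Variable R : realType.
Local Notation C := R[i].

Lemma conj_toC (x : R) : Num.conj (toC x) = toC x.
Proof. exact: conjc_real. Qed.

Lemma Re_toC (x : R) : complex.Re (toC x) = x.
Proof. by []. Qed.

Lemma toC_ge0 (x : R) : (0 <= toC x) = (0 <= x).
Proof. exact: ler0c. Qed.

Lemma toC_inj : injective (@toC R).
Proof. exact: complexI. Qed.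

Lemma toC_Re (z : C) : 0 <= z -> toC (complex.Re z) = z.
Proof. by move=> z0; apply: RRe_real; rewrite ger0_real. Qed.

Lemma Re_sum (X : finType) (P : pred X) (f : X -> C) :
  complex.Re (\sum_(x | P x) f x) = \sum_(x | P x) complex.Re (f x).
Proof. exact: (raddf_sum (@complex.Re R : Rcomplex R -> R)). Qed.

Lemma Re_add (x y : C) : complex.Re (x + y) = complex.Re x + complex.Re y.
Proof. by case: x; case: y. Qed.

Lemma Re_opp (x : C) : complex.Re (- x) = - complex.Re x.
Proof. by case: x. Qed.

Lemma Re_toCM (x : R) (y : C) : complex.Re (toC x * y) = x * complex.Re y.
Proof. by case: y => a b /=; rewrite mul0r subr0. Qed.

Lemma Re_ge0 (x : C) : 0 <= x -> 0 <= complex.Re x.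
Proof. by rewrite lecE => /andP[]. Qed.

Lemma ent_mkop (T : finType) (f : T -> T -> C) x y : ent (mkop f) x y = f x y.
Proof. by rewrite /ent mxE !enum_rankK. Qed.

Lemma op_eqP (T : finType) (A B : op R T) :
  (forall x y, ent A x y = ent B x y) -> A = B.
Proof.
move=> h; apply/matrixP => i j.
by have := h (enum_val i) (enum_val j); rewrite /ent !enum_valK.
Qed.

Lemma sum_enum_val (T : finType) (V : nmodType) (f : 'I_#|T| -> V) :
  \sum_i f i = \sum_(x : T) f (enum_rank x).
Proof.
rewrite (reindex_onto enum_rank enum_val) //= => [|i _]; rewrite ?enum_valK //.
by apply: eq_bigl => x; rewrite enum_rankK eqxx.
Qed.

Lemma entD (T : finType) (A B : op R T) x y : ent (A + B) x y = ent A x y + ent B x y.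
Proof. by rewrite /ent mxE. Qed.

Lemma entZ (T : finType) a (A : op R T) x y : ent (a *: A) x y = a * ent A x y.
Proof. by rewrite /ent mxE. Qed.

Lemma ent0 (T : finType) x y : ent (0 : op R T) x y = 0.
Proof. by rewrite /ent mxE. Qed.

Lemma ent_sum (T X : finType) (P : pred X) (A : X -> op R T) x y :
  ent (\sum_(i | P i) A i) x y = \sum_(i | P i) ent (A i) x y.
Proof. by rewrite /ent summxE. Qed.

Lemma tr_ent (T : finType) (A : op R T) : \tr A = \sum_x ent A x x.
Proof. by rewrite /mxtrace sum_enum_val. Qed.

Lemma psd_entP (T : finType) (A : op R T) :
  psd A <-> forall v : T -> C, 0 <= \sum_x \sum_y Num.conj (v x) * ent A x y * v y.
Proof.
have E (w : 'cV[C]_#|T|) : (adj w *m A *m w) 0 0 =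
    \sum_x \sum_y Num.conj (w (enum_rank x) 0) * ent A x y * w (enum_rank y) 0.
  rewrite exchange_big /= mxE sum_enum_val; apply: eq_bigr => y _.
  by rewrite mxE sum_enum_val mulr_suml; apply: eq_bigr => x _; rewrite !mxE.
split=> h v; last by rewrite E; apply: h.
have := h (\col_i v (enum_val i)); rewrite E.
by under eq_bigr do under eq_bigr do rewrite !mxE !enum_rankK.
Qed.

Lemma psdD (n : nat) (A B : 'M[C]_n) : psd A -> psd B -> psd (A + B).
Proof. by move=> a b v; rewrite mulmxDr mulmxDl mxE addr_ge0. Qed.

Lemma psd0 (n : nat) : psd (0 : 'M[C]_n).
Proof. by move=> v; rewrite mulmx0 mul0mx mxE. Qed.

Lemma psd_sum (n : nat) (X : finType) (P : pred X) (A : X -> 'M[C]_n) :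
  (forall x, P x -> psd (A x)) -> psd (\sum_(x | P x) A x).
Proof. by move=> h; apply: big_ind => //; [exact: psd0 | exact: psdD]. Qed.

Lemma psdZ (n : nat) (c : R) (A : 'M[C]_n) : 0 <= c -> psd A -> psd (toC c *: A).
Proof. by move=> c0 a v; rewrite -scalemxAr -scalemxAl mxE mulr_ge0 ?toC_ge0. Qed.

Lemma adjE (m n : nat) (A : 'M[C]_(m, n)) : adj A = (A ^t Num.conj)%sesqui.
Proof. by apply/matrixP => i j; rewrite !mxE. Qed.

Lemma adjK (m n : nat) (A : 'M[C]_(m, n)) : adj (adj A) = A.
Proof. by apply/matrixP => i j; rewrite !mxE conjCK. Qed.

Lemma adjM (m n p : nat) (A : 'M[C]_(m, n)) (B : 'M[C]_(n, p)) :
  adj (A *m B) = adj B *m adj A.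
Proof. by rewrite /adj map_mxM trmx_mul. Qed.

(** [psd] only asks the quadratic form to be nonnegative, hence real. So the form of [B = adj A - A]
    vanishes, and polarization with the coefficients [1] and ['i] kills every entry of [B]. *)
Lemma psd_herm (n : nat) (A : 'M[C]_n) : psd A -> adj A = A.
Proof.
move=> h; apply/eqP; rewrite -subr_eq0; apply/eqP.
set B := adj A - A.
have q0 (v : 'cV[C]_n) : (adj v *m B *m v) 0 0 = 0.
  rewrite mulmxBr mulmxBl mxE [X in _ + X]mxE.
  suff -> : (adj v *m adj A *m v) 0 0 = Num.conj ((adj v *m A *m v) 0 0).
    by have /CrealP -> := ger0_real (h v); rewrite subrr.
  have -> : adj v *m adj A *m v = adj (adj v *m A *m v).
    by rewrite !adjM adjK mulmxA.
  by rewrite !mxE.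
clearbody B; have bil (c : C) i j : Num.conj c * B i j * 1 =
    (adj (c *: delta_mx i 0 : 'cV_n) *m B *m (delta_mx j 0 : 'cV_n)) 0 0.
  rewrite -mulmxA -colE mxE (bigD1 i) //= big1 ?addr0; last first.
    by move=> k /negbTE ki; rewrite !mxE ki /= mulr0 conjC0 mul0r.
  by rewrite !mxE !eqxx /= !mulr1.
have bil2 (c : C) i j : B j i * c =
    (adj (delta_mx j 0 : 'cV_n) *m B *m (c *: delta_mx i 0 : 'cV_n)) 0 0.
  have := bil 1 j i; rewrite conjC1 mul1r mulr1 scale1r => ->.
  by rewrite -scalemxAr [RHS]mxE mulrC.
have key c i j : Num.conj c * B i j + B j i * c = 0.
  have := q0 (c *: delta_mx i 0 + delta_mx j 0).
  have -> (x y : 'cV[C]_n) : adj (x + y) = adj x + adj y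
    by apply/matrixP => ? ?; rewrite !mxE rmorphD.
  rewrite mulmxDr !mulmxDl mxE [X in X + _]mxE [X in _ + X]mxE.
  by rewrite !q0 add0r addr0 -bil -bil2 mulr1 addrC.
apply/matrixP => i j; rewrite mxE.
have k1 := key 1 i j; have k2 := key 'i i j.
rewrite conjC1 mul1r mulr1 in k1.
have BE : B j i = - B i j by apply/eqP; rewrite -addr_eq0 addrC k1.
have /eqP : 'i * ((B i j) *+ 2) = 0 :> C.
  by rewrite -oppr0 -k2 conjCi BE; ring.
by rewrite mulf_eq0 (negbTE (neq0Ci _)) mulrn_eq0 /= => /eqP.
Qed.

End Operators.

Local Notation eta := Defs.eta.

(** * Spectral decompositions and the entropy they determine *)

Section Entropy.
Variable R : realType.
Local Notation C := R[i].

Definition orthonormal_family (T X : finType) (v : X -> T -> C) : Prop :=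
  forall x y, \sum_t Num.conj (v x t) * v y t = (x == y)%:R.

(** The index type is free and the family need not span, so a decomposition may leave out part of
    the kernel: a pure state is indexed by [unit]. *)
Definition eigen_decomp (T X : finType) (A : op R T) (r : X -> R) (v : X -> T -> C) : Prop :=
  forall s t, ent A s t = \sum_x toC (r x) * v x s * Num.conj (v x t).

Lemma eta0 : eta (0 : R) = 0.
Proof. by rewrite /Defs.eta eqxx. Qed.

Lemma sum_delta (V : pzSemiRingType) (T : finType) (a : T) (f : T -> V) :
  \sum_x (a == x)%:R * f x = f a.
Proof.
rewrite (bigD1 a) //= eqxx mul1r big1 ?addr0 // => x.
by rewrite eq_sym => /negbTE ->; rewrite mul0r.
Qed.

Lemma eigen_vector (T X : finType) (A : op R T) (r : X -> R) (v : X -> T -> C) x s :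
  orthonormal_family v -> eigen_decomp A r v -> \sum_t ent A s t * v x t = toC (r x) * v x s.
Proof.
move=> ov dA; under eq_bigr do rewrite dA mulr_suml.
rewrite exchange_big /= -(sum_delta x (fun y => toC (r y) * v y s)).
apply: eq_bigr => y _; rewrite eq_sym -ov [RHS]mulrC mulr_sumr.
by apply: eq_bigr => t _; rewrite mulrA.
Qed.

Lemma eigen_decomp_sym (T X : finType) (A : op R T) (r : X -> R) (v : X -> T -> C) s t :
  eigen_decomp A r v -> Num.conj (ent A s t) = ent A t s.
Proof.
move=> dA; rewrite !dA rmorph_sum; apply: eq_bigr => x _ /=.
by rewrite !rmorphM /= conjCK conj_toC mulrAC.
Qed.

Lemma Re_sqnorm_toC (z : C) : toC (complex.Re (z * Num.conj z)) = z * Num.conj z.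
Proof. by apply: toC_Re; rewrite mul_conjC_ge0. Qed.

(* The overlaps [o] of the two families satisfy [r_x o_xy = q_y o_xy], so both sums
   equal the sum of [eta (r_x) |o_xy|^2]. *)
Lemma eta_sum_unique (T X Y : finType) (A : op R T) (r : X -> R) (v : X -> T -> C)
    (q : Y -> R) (w : Y -> T -> C) :
  orthonormal_family v -> eigen_decomp A r v -> orthonormal_family w -> eigen_decomp A q w ->
  \sum_x eta (r x) = \sum_y eta (q y).
Proof.
move=> ov dv ow dw.
pose o x y := \sum_t Num.conj (v x t) * w y t.
have roq x y : toC (r x) * o x y = toC (q y) * o x y.
  transitivity (\sum_s \sum_t Num.conj (v x s) * ent A s t * w y t).
    rewrite exchange_big /= mulr_sumr; apply: eq_bigr => t _.
    rewrite -mulr_suml mulrA; congr (_ * _).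
    have /(congr1 Num.conj) := eigen_vector x t ov dv.
    rewrite rmorphM /= conj_toC => <-; rewrite rmorph_sum; apply: eq_bigr => s _ /=.
    by rewrite rmorphM /= (eigen_decomp_sym _ _ dv) mulrC.
  rewrite mulr_sumr; apply: eq_bigr => s _.
  under eq_bigr do rewrite -mulrA.
  by rewrite -mulr_sumr (eigen_vector y s ow dw) mulrCA.
pose m x y := complex.Re (o x y * Num.conj (o x y)).
(* Stated for arbitrary families because it serves twice, the second time with the two
   decompositions exchanged. *)
have sum1 (X' Y' : finType) (r' : X' -> R) v' (q' : Y' -> R) w' :
    orthonormal_family v' -> eigen_decomp A r' v' -> orthonormal_family w' -> eigen_decomp A q' w' ->
    let o' x y := \sum_t Num.conj (v' x t) * w' y t in
    (forall x y, toC (r' x) * o' x y = toC (q' y) * o' x y) ->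
    forall x, eta (r' x) = \sum_y eta (r' x) * complex.Re (o' x y * Num.conj (o' x y)).
  move=> ov' dv' ow' dw' o' roq' x; rewrite -mulr_sumr.
  (* The squared overlaps with [w'] may sum to less than [1] when [r' x = 0], as [w'] need not span;
     then [eta (r' x)] is zero anyway. *)
  have [->|r0] := eqVneq (r' x) 0; first by rewrite eta0 mul0r.
  suff -> : \sum_y complex.Re (o' x y * Num.conj (o' x y)) = 1 by rewrite mulr1.
  apply: toC_inj; rewrite raddf_sum rmorph1 /=.
  under eq_bigr do rewrite Re_sqnorm_toC.
  have n0 : toC (r' x) != 0 by rewrite -(rmorph0 (@toC R)) (inj_eq (@toC_inj R)).
  apply: (mulfI n0); rewrite mulr1.
  (* Evaluate [<v'_x|A|v'_x>] in both decompositions. *)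
  transitivity (\sum_s \sum_t Num.conj (v' x s) * ent A s t * v' x t); last first.
    under eq_bigr => s _.
      under eq_bigr do rewrite -mulrA.
      rewrite -mulr_sumr (eigen_vector x s ov' dv') mulrCA.
      over.
    by rewrite -mulr_sumr ov' eqxx mulr1.
  rewrite mulr_sumr.
  under [RHS]eq_bigr do under eq_bigr do rewrite dw' mulr_sumr mulr_suml.
  under [RHS]eq_bigr do rewrite exchange_big.
  rewrite [RHS]exchange_big /=; apply: eq_bigr => y _.
  rewrite mulrA roq' -mulrA mulr_suml mulr_sumr; apply: eq_bigr => s _.
  rewrite rmorph_sum !mulr_sumr; apply: eq_bigr => t _ /=.
  rewrite rmorphM /= conjCK; ring.
rewrite (eq_bigr _ (fun x _ => sum1 _ _ _ _ _ _ ov dv ow dw roq x)).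
have roq' y x : toC (q y) * (\sum_t Num.conj (w y t) * v x t)
    = toC (r x) * (\sum_t Num.conj (w y t) * v x t).
  have -> : \sum_t Num.conj (w y t) * v x t = Num.conj (o x y).
    rewrite rmorph_sum; apply: eq_bigr => t _ /=.
    by rewrite rmorphM /= conjCK mulrC.
  by rewrite -{1}(conj_toC (q y)) -{1}(conj_toC (r x)) -!rmorphM /= roq.
rewrite [RHS](eq_bigr _ (fun y _ => sum1 _ _ _ _ _ _ ow dw ov dv roq' y)).
rewrite [RHS]exchange_big; apply: eq_bigr => x _; apply: eq_bigr => y _.
have -> : \sum_t Num.conj (w y t) * v x t = Num.conj (o x y).
  rewrite rmorph_sum; apply: eq_bigr => t _ /=.
  by rewrite rmorphM /= conjCK mulrC.
rewrite conjCK [Num.conj _ * _]mulrC -/(o x y).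
have [->|o0] := eqVneq (o x y) 0; first by rewrite mul0r !mulr0.
by have /toC_inj -> := mulIf o0 (roq x y).
Qed.

Definition eigval (n : nat) (A : 'M[C]_n) (i : 'I_n) : R :=
  complex.Re (spectral_diag A 0 i).

(** The adjoint puts the eigenvectors of a positive [A] in the columns. *)
Definition eigmx (n : nat) (A : 'M[C]_n) : 'M[C]_n := adj (spectralmx A).

Lemma eigmx_unitary (n : nat) (A : 'M[C]_n) : adj (eigmx A) *m eigmx A = 1%:M.
Proof.
by have /unitarymxP := spectral_unitarymx A; rewrite /eigmx adjK adjE.
Qed.

Lemma eigmx_unitaryr (n : nat) (A : 'M[C]_n) : eigmx A *m adj (eigmx A) = 1%:M.
Proof.
by rewrite /eigmx adjK adjE -invmx_unitary ?spectral_unitarymx // mulVmx // spectral_unit.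
Qed.

Lemma eigmx_diag (n : nat) (A : 'M[C]_n) : psd A ->
  A = eigmx A *m diag_mx (\row_i toC (eigval A i)) *m adj (eigmx A).
Proof.
move=> psdA; have hA := psd_herm psdA.
have herm : A \is hermsymmx.
  apply/is_hermitianmxP; rewrite expr0 scale1r -[LHS]hA.
  by apply/matrixP => i j; rewrite !mxE.
have /orthomx_spectralP := hermitian_normalmx herm.
rewrite invmx_unitary ?spectral_unitarymx // => dA.
rewrite {1}dA /eigmx adjK adjE; congr (_ *m diag_mx _ *m _).
apply/rowP => i; rewrite mxE /eigval /toC RRe_real //.
have /mxOverP := hermitian_spectral_diag_real herm; exact.
Qed.

Lemma eigval_conj (n : nat) (A : 'M[C]_n) i : psd A ->
  (adj (eigmx A) *m A *m eigmx A) i i = toC (eigval A i).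
Proof.
move=> pA; rewrite {2}(eigmx_diag pA) !mulmxA eigmx_unitary mul1mx -mulmxA.
by rewrite eigmx_unitary mulmx1 !mxE eqxx mulr1n.
Qed.

Lemma psd_conj (m n : nat) (A : 'M[C]_n) (B : 'M[C]_(n, m)) :
  psd A -> psd (adj B *m A *m B).
Proof. by move=> pA v; have := pA (B *m v); rewrite adjM !mulmxA. Qed.

Lemma psd_diag_ge0 (n : nat) (A : 'M[C]_n) i : psd A -> 0 <= A i i.
Proof.
move=> /(_ (delta_mx i 0)); rewrite -mulmxA -colE mxE (bigD1 i) //= big1 ?addr0.
  by rewrite !mxE !eqxx /= conjC1 mul1r.
by move=> j /negbTE ji; rewrite !mxE ji /= conjC0 mul0r.
Qed.

Lemma eigval_ge0 (n : nat) (A : 'M[C]_n) i : psd A -> 0 <= eigval A i.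
Proof. by move=> pA; rewrite -toC_ge0 -eigval_conj //; apply/psd_diag_ge0/psd_conj. Qed.

Lemma spectral_decomp (T : finType) (A : op R T) : psd A ->
  exists v : 'I_#|T| -> T -> C,
    [/\ orthonormal_family v, eigen_decomp A (eigval A) v & forall i, 0 <= eigval A i].
Proof.
move=> pA; exists (fun i t => eigmx A (enum_rank t) i); split.
- move=> i j; have /matrixP/(_ i j) := eigmx_unitary A.
  by rewrite !mxE => <-; rewrite sum_enum_val; apply: eq_bigr => t _; rewrite !mxE.
- move=> s t; rewrite /ent {1}(eigmx_diag pA) mxE; apply: eq_bigr => i _.
  rewrite mxE (bigD1 i) //= big1 ?addr0; last first.
    by move=> j /negbTE ji; rewrite [diag_mx _ _ _]mxE ji mulr0n mulr0.
  by rewrite !mxE eqxx mulr1n [_ * toC _]mulrC.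
- by move=> i; apply: eigval_ge0.
Qed.

(** Frees the entropy from the eigenbasis picked by [spectral_diag]: the entropy rules below exhibit
    whichever eigendecomposition is convenient. *)
Lemma entropy_eigen (T X : finType) (A : op R T) (r : X -> R) (v : X -> T -> C) :
  psd A -> orthonormal_family v -> eigen_decomp A r v -> vN_entropy A = \sum_x eta (r x).
Proof.
by move=> /spectral_decomp[w [ow dw _]] ov dv; apply: (eta_sum_unique ow dw ov dv).
Qed.

End Entropy.

(** * Computation rules for the von Neumann entropy *)

Section EntropyCalculus.
Variable R : realType.
Local Notation C := R[i].

Lemma psd_eigen (T X : finType) (A : op R T) (r : X -> R) (v : X -> T -> C) :
  (forall x, 0 <= r x) -> eigen_decomp A r v -> psd A.
Proof.
move=> r0 dA; apply/psd_entP => w.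
under eq_bigr do under eq_bigr do rewrite dA mulr_sumr mulr_suml.
under eq_bigr do rewrite exchange_big.
rewrite exchange_big /= sumr_ge0 // => x _.
pose z := \sum_s Num.conj (w s) * v x s.
suff -> : \sum_s \sum_t Num.conj (w s) * (toC (r x) * v x s * Num.conj (v x t)) * w t
    = toC (r x) * (z * Num.conj z).
  by rewrite mulr_ge0 ?toC_ge0 // mul_conjC_ge0.
rewrite mulr_suml mulr_sumr; apply: eq_bigr => s _.
rewrite rmorph_sum !mulr_sumr; apply: eq_bigr => t _ /=.
rewrite rmorphM /= conjCK; ring.
Qed.

Lemma tr_eigen (T X : finType) (A : op R T) (r : X -> R) (v : X -> T -> C) :
  orthonormal_family v -> eigen_decomp A r v -> complex.Re (\tr A) = \sum_x r x.
Proof.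
move=> ov dA; rewrite tr_ent; under eq_bigr do rewrite dA.
rewrite exchange_big Re_sum; apply: eq_bigr => x _.
under eq_bigr do rewrite -mulrA.
rewrite -mulr_sumr; under eq_bigr do rewrite mulrC.
by rewrite ov eqxx mulr1.
Qed.

Lemma eta1 : eta (1 : R) = 0.
Proof. by rewrite /Defs.eta /log2 ln1 mul0r mulr0 oppr0 if_same. Qed.

(** The logarithm of a product read as a Leibniz rule; it extends to zero arguments by the
    convention [eta 0 = 0]. *)
Lemma etaM (a b : R) : 0 <= a -> 0 <= b -> eta (a * b) = a * eta b + eta a * b.
Proof.
move=> a0 b0; have [->|an0] := eqVneq a 0; first by rewrite mul0r eta0 !mul0r addr0.
have [->|bn0] := eqVneq b 0; first by rewrite mulr0 eta0 !mulr0 addr0.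
rewrite /Defs.eta mulf_eq0 (negbTE an0) (negbTE bn0) /= /log2 lnM ?posrE ?lt0r ?an0 ?bn0 //.
by rewrite mulrDl; ring.
Qed.

Lemma eta_prod (n : nat) (a : 'I_n -> R) : (forall k, 0 <= a k) ->
  eta (\prod_k a k) = \sum_k \prod_l (if l == k then eta (a l) else a l).
Proof.
elim: n a => [|n IH] a a0; first by rewrite big_ord0 big_ord0 eta1.
rewrite !big_ord_recl etaM ?prodr_ge0 // IH // [RHS]addrC; congr (_ + _).
rewrite mulr_sumr; apply: eq_bigr => k _; rewrite big_ord_recl /=.
by congr (_ * _); apply: eq_bigr => l _; rewrite (inj_eq lift_inj).
Qed.

(** In the [k]-th Leibniz term every factor except the [k]-th sums to [1]. *)
Lemma sum_eta_prod (X : finType) (n : nat) (r : X -> R) :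
  (forall x, 0 <= r x) -> \sum_x r x = 1 ->
  \sum_(f : {ffun 'I_n -> X}) eta (\prod_k r (f k)) = n%:R * \sum_x eta (r x).
Proof.
move=> r0 r1; under eq_bigr do rewrite eta_prod //.
rewrite exchange_big /= -[n in n%:R]card_ord -sum1_card natr_sum mulr_suml.
apply: eq_bigr => k _; rewrite mul1r.
rewrite -(bigA_distr_bigA (fun l x => if l == k then eta (r x) else r x)) /=.
rewrite (bigD1 k) //= [X in _ * X]big1 ?mulr1; last by move=> l /negbTE ->.
by apply: eq_bigr => x _; rewrite eqxx.
Qed.

Lemma entropy_block (T S U : finType) (h : T -> S * U) (A : op R T) (B : S -> op R U) :
  bijective h -> (forall s, psd (B s)) ->
  (forall x y, ent A x y =
     ((h x).1 == (h y).1)%:R * ent (B (h x).1) (h x).2 (h y).2) ->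
  psd A /\ vN_entropy A = \sum_s vN_entropy (B s).
Proof.
move=> [g hK gK] pB hA.
have /choice[w hw] := fun s => spectral_decomp (pB s).
pose r (x : S * 'I_#|U|) := eigval (B x.1) x.2.
pose v (x : S * 'I_#|U|) t := (x.1 == (h t).1)%:R * w x.1 x.2 (h t).2.
have r0 x : 0 <= r x by have [_ _] := hw x.1; apply.
have dA : eigen_decomp A r v.
  move=> s t; rewrite hA.
  transitivity (\sum_a \sum_i toC (r (a, i)) * v (a, i) s * Num.conj (v (a, i) t)); last first.
    by rewrite pair_bigA; apply: eq_bigr => -[].
  rewrite [RHS](bigD1 (h s).1) //= [X in _ + X]big1 ?addr0; last first.
    move=> a ha; rewrite big1 // => i _.
    by rewrite /v /= (negbTE ha) mul0r mulr0 mul0r.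
  have [_ -> _] := hw (h s).1.
  rewrite mulr_sumr; apply: eq_bigr => i _; rewrite /v /= eqxx /r /=.
  by rewrite rmorphM /= conjC_nat; ring.
have ov : orthonormal_family v.
  move=> [a i] [b j]; rewrite /v /=.
  rewrite (reindex g) /=; last by exists h => x _; rewrite ?hK ?gK.
  under eq_bigr do rewrite gK.
  transitivity (\sum_c \sum_u Num.conj ((a == c)%:R * w a i u) * ((b == c)%:R * w b j u)).
    by rewrite pair_bigA.
  under eq_bigr => c _.
    under eq_bigr do rewrite rmorphM /= conjC_nat -mulrA.
    rewrite -mulr_sumr; over.
  rewrite sum_delta xpair_eqE /=.
  under eq_bigr do rewrite mulrCA.
  rewrite -mulr_sumr; have [<-|] := eqVneq a b; last by rewrite mul0r.
  by rewrite mul1r; have [-> _ _] := hw a.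
have pA := psd_eigen r0 dA; split => //.
by rewrite (entropy_eigen pA ov dA) pair_bigA.
Qed.

Lemma entropy_diag (T : finType) (A : op R T) (w : T -> R) :
  (forall x, 0 <= w x) -> (forall x y, ent A x y = (x == y)%:R * toC (w x)) ->
  vN_entropy A = \sum_x eta (w x).
Proof.
move=> w0 hA; pose v (x : T) t : C := (x == t)%:R.
have dA : eigen_decomp A w v.
  move=> s t; rewrite hA /v.
  rewrite mulrC -(sum_delta s (fun x => toC (w x) * (s == t)%:R)) [RHS](bigD1 s) //=.
  rewrite [in LHS](bigD1 s) //= !big1 ?addr0 => [|x /negbTE xs|x /negbTE xs].
  - by rewrite eqxx conjC_nat mul1r mulr1.
  - by rewrite xs mulr0 mul0r.
  - by rewrite eq_sym xs mul0r.
have ov : orthonormal_family v.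
  move=> x y; under eq_bigr do rewrite conjC_nat.
  by rewrite sum_delta /v eq_sym.
exact: (entropy_eigen (psd_eigen w0 dA) ov dA).
Qed.

(** The Leibniz rule on the spectrum. The trace stays in the formula because the blocks met below
    are not normalized. *)
Lemma entropyZ (T : finType) (A : op R T) (c : R) : psd A -> 0 <= c ->
  vN_entropy (toC c *: A) = c * vN_entropy A + eta c * complex.Re (\tr A).
Proof.
move=> pA c0; have [v [ov dA r0]] := spectral_decomp pA.
set r := eigval A in dA r0.
have dcA : eigen_decomp (toC c *: A) (fun x => c * r x) v.
  move=> s t; rewrite entZ dA mulr_sumr; apply: eq_bigr => x _.
  by rewrite rmorphM /= !mulrA.
rewrite (entropy_eigen (psdZ c0 pA) ov dcA) (tr_eigen ov dA) /vN_entropy.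
by rewrite !mulr_sumr -big_split; apply: eq_bigr => x _; rewrite etaM //; apply: r0.
Qed.

Lemma sqnorm_unit (T : finType) (psi : T -> C) : unit_ket psi ->
  \sum_t psi t * Num.conj (psi t) = 1.
Proof. by move=> <-; apply: eq_bigr => t _; rewrite normCK. Qed.

Lemma psd_ket_proj (T : finType) (psi : T -> C) : psd (ket_proj psi).
Proof.
apply: (@psd_eigen _ unit _ (fun=> 1) (fun=> psi)) => // s t.
rewrite ent_mkop (bigD1 tt) //= big1 => [|[]//].
by rewrite addr0 rmorph1 mul1r.
Qed.

Lemma entropy_ket_proj (T : finType) (psi : T -> C) : unit_ket psi ->
  vN_entropy (ket_proj psi) = 0.
Proof.
move=> u1; rewrite (@entropy_eigen _ _ unit _ (fun=> 1) (fun=> psi)).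
- by rewrite big1 // => _ _; rewrite eta1.
- exact: psd_ket_proj.
- by move=> [] []; rewrite -[RHS](sqnorm_unit u1); apply: eq_bigr => t _; rewrite mulrC.
- move=> s t; rewrite ent_mkop (bigD1 tt) //= big1 => [|[]//].
  by rewrite addr0 rmorph1 mul1r.
Qed.

(** Products of eigenvectors are eigenvectors, and the products of eigenvalues are handled by
    [sum_eta_prod]. *)
Lemma entropy_tensor_power (T : finType) (n : nat) (A : op R T)
    (B : op R {ffun 'I_n -> T}) : psd A -> \tr A = 1 ->
  (forall x y, ent B x y = \prod_k ent A (x k) (y k)) ->
  vN_entropy B = n%:R * vN_entropy A.
Proof.
move=> pA t1 hB; have [v [ov dA r0]] := spectral_decomp pA.
set r := eigval A in dA r0.
pose w (f : {ffun 'I_n -> 'I_#|T|}) (x : {ffun 'I_n -> T}) := \prod_k v (f k) (x k).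
have dB : eigen_decomp B (fun f : {ffun 'I_n -> 'I_#|T|} => \prod_k r (f k)) w.
  move=> s t; rewrite hB; under eq_bigr do rewrite dA.
  rewrite bigA_distr_bigA; apply: eq_bigr => f _.
  by rewrite rmorph_prod /w rmorph_prod -!big_split.
have ow : orthonormal_family w.
  move=> f g; transitivity (\prod_k \sum_t Num.conj (v (f k) t) * v (g k) t).
    rewrite bigA_distr_bigA; apply: eq_bigr => x _.
    by rewrite /w rmorph_prod -big_split.
  under eq_bigr do rewrite ov.
  have [->|] := eqVneq f g; first by rewrite big1 // => k _; rewrite eqxx.
  move/eqP => fg; have [k fgk] : exists k, f k != g k.
    apply/existsP; apply: contra_notT fg => /existsPn h.
    by apply/ffunP => k; have /negbNE/eqP := h k.
  by rewrite (bigD1 k) //= (negbTE fgk) mul0r.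
have f0 (f : {ffun 'I_n -> 'I_#|T|}) : 0 <= \prod_k r (f k) by apply: prodr_ge0 => k _; apply: r0.
rewrite (entropy_eigen (psd_eigen f0 dB) ow dB) sum_eta_prod //.
by rewrite -(tr_eigen ov dA) t1.
Qed.

End EntropyCalculus.

(** * Monotonicity of relative entropy *)

Section LogRational.
Variable R : realType.

(** The tangent bound [ln (1 + x) <= x] at [x = b / a - 1]. Used with both orders of [a] and [b], it
    gives both bounds on a Riemann step. *)
Lemma ln_step (a b : R) : 0 < a -> 0 < b ->
  a - b <= a * (ln a - ln b).
Proof.
move=> a0 b0; have ba0 : 0 < b / a by rewrite divr_gt0.
have := @le_ln1Dx R (b / a - 1); rewrite addrCA subrr addr0.
have -> : ln (b / a) = ln b - ln a by rewrite ln_div ?posrE.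
have ltm1 : -1 < b / a - 1 by lra.
move=> /(_ ltm1) /(ler_wpM2l (ltW a0)).
rewrite [X in _ <= X](_ : _ = b - a); last by field; rewrite gt_eqF.
lra.
Qed.

(* [rat_log N r q] is the Riemann sum with [N] steps of the integral representation
   [r ln (r / q) = - \int_0^1 r (q - r) / (r + s (q - r)) ds]. *)
Definition rat_c (N k : nat) : R := N%:R / k.+1%:R ^+ 2.
Definition rat_d (k : nat) : R := k.+1%:R^-1.
Definition rat_t (N k : nat) : R := N%:R / k.+1%:R - 1.

Definition rat_log (N : nat) (r q : R) : R :=
  \sum_(k < N) (rat_c N k * (r ^+ 2 / (q + rat_t N k * r)) - rat_d k * r).

(** Along the segment [b] from [r] to [q], each increment of the logarithm lies between its two
    endpoint estimates. [rat_log] uses the endpoint [b k.+1], and the total gap to the choice [b k]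
    telescopes to [(q - r)^2 / (q N)]. *)
Lemma rat_log_bounds (N : nat) (r q : R) : (0 < N)%N -> 0 < r -> 0 < q ->
  r * (ln r - ln q) <= rat_log N r q <= r * (ln r - ln q) + (q - r) ^+ 2 / q / N%:R.
Proof.
move=> N0 r0 q0; have Nr : 0 < N%:R :> R by rewrite ltr0n.
pose b (k : nat) : R := r + k%:R / N%:R * (q - r).
have b0 k : (k <= N)%N -> 0 < b k.
  move=> kN; rewrite /b; set s := k%:R / N%:R.
  have s0 : 0 <= s by rewrite divr_ge0.
  have s1 : s <= 1 by rewrite ler_pdivrMr // mul1r ler_nat.
  rewrite (_ : _ + _ = (1 - s) * r + s * q); last by ring.
  have [->|sn] := eqVneq s 0; first by rewrite subr0 mul1r mul0r addr0.
  have h1 : 0 < s * q by rewrite mulr_gt0 // lt0r sn.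
  have h2 : 0 <= (1 - s) * r by rewrite mulr_ge0 ?subr_ge0 // ltW.
  lra.
have termE (k : 'I_N) : rat_c N k * (r ^+ 2 / (q + rat_t N k * r)) - rat_d k * r
    = r * ((r - q) / N%:R / b k.+1).
  (* This is where [rat_t] comes from: [q + rat_t N k * r] is the node [b k.+1] up to the factor
     [k.+1 / N]. *)
  have bk : b k.+1 = k.+1%:R / N%:R * (q + rat_t N k * r).
    rewrite /b /rat_t; field; by rewrite !gt_eqF // ltr0n.
  have b1 : 0 < q + rat_t N k * r.
    by have := b0 k.+1 (ltn_ord k); rewrite bk pmulr_rgt0 // divr_gt0 // ltr0n.
  have K0 : 0 < k.+1%:R :> R by rewrite ltr0n.
  have t1 : 0 < rat_t N k + 1 by rewrite /rat_t subrK divr_gt0.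
  have NE : N%:R = (rat_t N k + 1) * k.+1%:R by rewrite /rat_t subrK divfK // gt_eqF.
  rewrite bk /rat_c /rat_d NE; move: t1 b1 K0; set t := rat_t N k; set K := k.+1%:R.
  by move=> t1 b1 K0; field; rewrite !gt_eqF.
have lnE : r * (ln r - ln q) = \sum_(k < N) r * (ln (b k) - ln (b k.+1)).
  rewrite -mulr_sumr; congr (_ * _).
  rewrite -(big_mkord predT (fun k => ln (b k) - ln (b k.+1))).
  rewrite (@telescope_sumr_eq _ _ _ (fun k => - ln (b k))) //; last by move=> k _; ring.
  by rewrite /b mul0r mul0r addr0 divff ?gt_eqF // mul1r subrKC opprK addrC.
have diffb k : b k - b k.+1 = (r - q) / N%:R.
  by rewrite /b -natr1; field; rewrite gt_eqF.
rewrite /rat_log (eq_bigr _ (fun k _ => termE k)) lnE; apply/andP; split.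
  apply: ler_sum => k _; rewrite ler_wpM2l ?(ltW r0) // -(diffb k).
  have bk := b0 _ (ltnW (ltn_ord k)); have bk1 := b0 _ (ltn_ord k).
  have := ln_step bk1 bk; rewrite ler_pdivlMr // mulrC.
  lra.
have -> : (q - r) ^+ 2 / q / N%:R =
    \sum_(k < N) r * ((q - r) / N%:R * ((b k)^-1 - (b k.+1)^-1)).
  rewrite -mulr_sumr -mulr_sumr.
  rewrite -(big_mkord predT (fun k => (b k)^-1 - (b k.+1)^-1)).
  rewrite (@telescope_sumr_eq _ _ _ (fun k => - (b k)^-1)) //; last by move=> k _; ring.
  rewrite /b mul0r mul0r addr0 divff ?gt_eqF // mul1r subrKC.
  by field; rewrite !gt_eqF.
rewrite -big_split; apply: ler_sum => k _ /=; rewrite -mulrDr ler_wpM2l ?(ltW r0) //.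
have bk := b0 _ (ltnW (ltn_ord k)); have bk1 := b0 _ (ltn_ord k).
have := ln_step bk bk1; rewrite diffb -ler_pdivrMl // mulrC.
rewrite (_ : (q - r) / N%:R = - ((r - q) / N%:R)); last by rewrite -mulNr opprB.
set u := (r - q) / N%:R; lra.
Qed.

End LogRational.

(** * Relative entropy, its rational approximants and their variational form *)

Section RelativeEntropy.
Variable R : realType.
Local Notation C := R[i].

Definition sqmod (z : C) : R := complex.Re (z * Num.conj z).

Lemma sqmod_ge0 z : 0 <= sqmod z.
Proof. by apply: Re_ge0; rewrite mul_conjC_ge0. Qed.

Lemma sqmod_toC z : toC (sqmod z) = z * Num.conj z.
Proof. exact: Re_sqnorm_toC. Qed.

Lemma sqmod_eq0 z : sqmod z = 0 -> z = 0.
Proof.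
move=> /(congr1 (@toC R)); rewrite sqmod_toC rmorph0 => /eqP.
by rewrite mul_conjC_eq0 => /eqP.
Qed.

(** Complete the square in [x]. If the denominator vanishes, the right side is [0] by the convention
    on inverses, and the support condition removes the linear term. *)
Lemma quadratic_le (r q t : R) (x o : C) : 0 <= r -> 0 <= q -> 0 <= t ->
  (q = 0 -> r * sqmod o = 0) ->
  2 * (r * complex.Re (x * Num.conj o)) - (q + t * r) * sqmod x
    <= sqmod o * (r ^+ 2 / (q + t * r)).
Proof.
move=> r0 q0 t0 supp.
have [g0|gn] := eqVneq (q + t * r) 0.
  rewrite g0 mul0r subr0 invr0 !mulr0.
  have tr0 : 0 <= t * r by rewrite mulr_ge0.
  have /supp/eqP : q = 0 by lra.
  rewrite mulf_eq0 => /orP[/eqP ->|/eqP/sqmod_eq0 ->]; first by rewrite mul0r mulr0.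
  by rewrite conjC0 !mulr0.
have gp : 0 < q + t * r by rewrite lt0r gn addr_ge0 // mulr_ge0.
set g := q + t * r in gn gp *.
rewrite [X in _ <= X]mulrA ler_pdivlMr //.
have -> : complex.Re (x * Num.conj o) = complex.Re x * complex.Re o + complex.Im x * complex.Im o.
  by clear supp; case: x o => [a b] [c d] /=; rewrite mulrN opprK.
have E z : sqmod z = complex.Re z ^+ 2 + complex.Im z ^+ 2.
  by case: z => a b; rewrite /sqmod /= !expr2 mulrN opprK.
rewrite !E; set a := complex.Re x; set b := complex.Im x.
set c := complex.Re o; set d := complex.Im o.
have h1 := sqr_ge0 (g * a - r * c); have h2 := sqr_ge0 (g * b - r * d).
rewrite -subr_ge0 [X in 0 <= X](_ : _ = (g * a - r * c) ^+ 2 + (g * b - r * d) ^+ 2); last by ring.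
exact: addr_ge0.
Qed.

Lemma quadratic_attained (r g : R) (o : C) :
  let x := toC (r / g) * o in
  2 * (r * complex.Re (x * Num.conj o)) - g * sqmod x = sqmod o * (r ^+ 2 / g).
Proof.
move=> x.
have -> : complex.Re (x * Num.conj o) = r / g * sqmod o by rewrite /x -mulrA Re_toCM.
have -> : sqmod x = (r / g) ^+ 2 * sqmod o.
  rewrite /sqmod /x (rmorphM Num.conj) /= conj_toC.
  have -> : toC (r / g) * o * (toC (r / g) * Num.conj o) = toC ((r / g) ^+ 2) * (o * Num.conj o).
    rewrite rmorphXn /=; ring.
  by rewrite Re_toCM.
have [->|gn] := eqVneq g 0; first by rewrite invr0 !mulr0 !mul0r !mulr0 subrr.
by field.
Qed.

Section Pair.
Variable n : nat.
Implicit Types rho sig X : 'M[C]_n.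

Definition overlap rho sig : 'M[C]_n := adj (eigmx rho) *m eigmx sig.
Definition weight rho sig i j : R := sqmod (overlap rho sig i j).

Lemma mx_sqmod_row m p (A : 'M[C]_(m, p)) i :
  complex.Re ((A *m adj A) i i) = \sum_j sqmod (A i j).
Proof. by rewrite mxE Re_sum; apply: eq_bigr => j _; rewrite !mxE. Qed.

Lemma mx_sqmod_col m p (A : 'M[C]_(m, p)) j :
  complex.Re ((adj A *m A) j j) = \sum_i sqmod (A i j).
Proof. by rewrite mxE Re_sum; apply: eq_bigr => i _; rewrite !mxE /sqmod mulrC. Qed.

Lemma weight_row rho sig i : \sum_j weight rho sig i j = 1.
Proof.
rewrite -mx_sqmod_row /overlap adjM adjK mulmxA -(mulmxA _ (eigmx sig)).
by rewrite eigmx_unitaryr mulmx1 eigmx_unitary mxE eqxx.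
Qed.

Lemma diag_eig rho sig j : psd rho ->
  complex.Re ((adj (eigmx sig) *m rho *m eigmx sig) j j) =
  \sum_i weight rho sig i j * eigval rho i.
Proof.
move=> pr; rewrite {1}(eigmx_diag pr) !mulmxA.
have -> : adj (eigmx sig) *m eigmx rho = adj (overlap rho sig) by rewrite adjM adjK.
rewrite -mulmxA -/(overlap rho sig) mul_mx_diag mxE Re_sum; apply: eq_bigr => i _.
rewrite mxE [X in _ * X * _]mxE [X in X * _ * _]mxE [X in X * _ * _]mxE /weight /sqmod.
set o := overlap _ _ i j.
have -> : Num.conj o * toC (eigval rho i) * o = toC (eigval rho i) * (o * Num.conj o) by ring.
by rewrite Re_toCM mulrC.
Qed.

(** The relative entropy [Tr rho (ln rho - ln sig)], in natural logarithms, expanded over the two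
    eigenbases. It is used below under [psd (sig - rho)], which makes the support of [sig] contain
    that of [rho]. *)
Definition relent rho sig : R :=
  \sum_i \sum_j weight rho sig i j *
    (eigval rho i * (ln (eigval rho i) - ln (eigval sig j))).

(** What [relent] becomes when the logarithm gives way to [x |-> 1 / (x + t)]; [rel_var] is its
    variational form. *)
Definition rel_quad (t : R) rho sig : R :=
  \sum_i \sum_j weight rho sig i j *
    (eigval rho i ^+ 2 / (eigval sig j + t * eigval rho i)).

Definition rel_var (t : R) rho sig X : R :=
  2 * complex.Re (\tr (rho *m X)) - complex.Re (\tr (sig *m (adj X *m X)))
  - t * complex.Re (\tr (rho *m (X *m adj X))).

Lemma tr_diag_mul (r : 'I_n -> R) (A : 'M[C]_n) :
  complex.Re (\tr (diag_mx (\row_i toC (r i)) *m A)) = \sum_i r i * complex.Re (A i i).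
Proof.
rewrite /mxtrace Re_sum; apply: eq_bigr => i _.
by rewrite mul_diag_mx !mxE Re_toCM.
Qed.

Lemma tr_eig (A B : 'M[C]_n) : psd A ->
  complex.Re (\tr (A *m B)) =
  \sum_i eigval A i * complex.Re ((adj (eigmx A) *m B *m eigmx A) i i).
Proof.
by move=> pA; rewrite {1}(eigmx_diag pA) -!mulmxA mxtrace_mulC -mulmxA tr_diag_mul mulmxA.
Qed.

(** With rows in the eigenbasis of [rho] and columns in that of [sig], the functional splits into
    one scalar quadratic per entry of [x]. *)
Lemma rel_varE t rho sig X : psd rho -> psd sig ->
  let x := adj (eigmx rho) *m X *m eigmx sig in
  rel_var t rho sig X = \sum_i \sum_j
   (2 * (eigval rho i * complex.Re (x i j * Num.conj (overlap rho sig i j)))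
   - (eigval sig j + t * eigval rho i) * sqmod (x i j)).
Proof.
move=> pr ps x.
have e1 : complex.Re (\tr (rho *m X)) = \sum_i \sum_j
    eigval rho i * complex.Re (x i j * Num.conj (overlap rho sig i j)).
  rewrite tr_eig //.
  apply: eq_bigr => i _; rewrite -mulr_sumr; congr (_ * _).
  have -> : adj (eigmx rho) *m X *m eigmx rho = x *m adj (overlap rho sig).
    by rewrite /x /overlap adjM adjK !mulmxA -(mulmxA _ (eigmx sig)) eigmx_unitaryr mulmx1.
  by rewrite mxE Re_sum; apply: eq_bigr => j _; rewrite !mxE.
have e2 : complex.Re (\tr (sig *m (adj X *m X))) = \sum_i \sum_j eigval sig j * sqmod (x i j).
  rewrite tr_eig // exchange_big.
  have xE : adj x *m x = adj (eigmx sig) *m (adj X *m X) *m eigmx sig.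
    rewrite /x 2!adjM (adjK (eigmx rho)) -!mulmxA (mulmxA (eigmx rho)).
    by rewrite eigmx_unitaryr mul1mx.
  by apply: eq_bigr => j _; rewrite -mulr_sumr -mx_sqmod_col xE.
have e3 : complex.Re (\tr (rho *m (X *m adj X))) = \sum_i \sum_j eigval rho i * sqmod (x i j).
  rewrite tr_eig //.
  have xE : x *m adj x = adj (eigmx rho) *m (X *m adj X) *m eigmx rho.
    rewrite /x 2!adjM (adjK (eigmx rho)) -!mulmxA (mulmxA (eigmx sig)).
    by rewrite eigmx_unitaryr mul1mx.
  by apply: eq_bigr => i _; rewrite -mulr_sumr -mx_sqmod_row xE.
rewrite /rel_var e1 e2 e3 !mulr_sumr -!sumrB; apply: eq_bigr => i _.
rewrite !mulr_sumr -!sumrB; apply: eq_bigr => j _; ring.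
Qed.

(** Here [<j|rho|j> <= <j|sig|j> = 0], and the left side is a sum of nonnegative terms. *)
Lemma weight_support rho sig i j : psd rho -> psd sig -> psd (sig - rho) ->
  eigval sig j = 0 -> eigval rho i * weight rho sig i j = 0.
Proof.
move=> pr ps pd q0.
have h : 0 <= (adj (eigmx sig) *m (sig - rho) *m eigmx sig) j j.
  exact/psd_diag_ge0/psd_conj.
move: h; rewrite mulmxBr mulmxBl mxE eigval_conj // q0 rmorph0 add0r mxE => /Re_ge0.
rewrite Re_opp oppr_ge0 diag_eig // => le0.
have ge0 k : 0 <= weight rho sig k j * eigval rho k by rewrite mulr_ge0 ?sqmod_ge0 ?eigval_ge0.
have /eqP : \sum_k weight rho sig k j * eigval rho k = 0.
  by apply/le_anti; rewrite le0 sumr_ge0.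
by rewrite psumr_eq0 // => /allP/(_ i); rewrite mem_index_enum mulrC => /(_ isT)/eqP.
Qed.

Lemma rel_var_le t rho sig X : 0 <= t -> psd rho -> psd sig -> psd (sig - rho) ->
  rel_var t rho sig X <= rel_quad t rho sig.
Proof.
move=> t0 pr ps pd; rewrite rel_varE //; apply: ler_sum => i _; apply: ler_sum => j _.
apply: quadratic_le => //; try exact: eigval_ge0.
exact: weight_support.
Qed.

Lemma rel_var_attained t rho sig : psd rho -> psd sig ->
  exists X, rel_var t rho sig X = rel_quad t rho sig.
Proof.
(* The entrywise maximizer of [quadratic_attained], to be carried back from the two eigenbases. *)
move=> pr ps; pose Y := \matrix_(i, j)
  (toC (eigval rho i / (eigval sig j + t * eigval rho i)) * overlap rho sig i j).
exists (eigmx rho *m Y *m adj (eigmx sig)).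
rewrite rel_varE //= !mulmxA eigmx_unitary mul1mx -mulmxA eigmx_unitary mulmx1.
apply: eq_bigr => i _; apply: eq_bigr => j _; rewrite mxE.
exact: quadratic_attained.
Qed.

(** The constant [e] is independent of [N], so an inequality between the approximants passes to
    [relent] in the limit. *)
Lemma relent_approx rho sig : psd rho -> psd sig -> psd (sig - rho) ->
  exists e : R, forall N, (0 < N)%N ->
   let q := \sum_(k < N) (rat_c R N k * rel_quad (rat_t R N k) rho sig
                          - rat_d R k * complex.Re (\tr rho)) in
   relent rho sig <= q <= relent rho sig + e / N%:R.
Proof.
move=> pr ps pd.
(* Only pairs of positive eigenvalues carry an error: terms with [eigval rho i = 0] vanish, and if
   only [eigval sig j] is zero, then [weight_support] makes the weight zero. *)
pose err i j := if (0 < eigval rho i) && (0 < eigval sig j) then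
  weight rho sig i j * ((eigval sig j - eigval rho i) ^+ 2 / eigval sig j) else 0.
exists (\sum_i \sum_j err i j) => N N0 /=.
have tr1 : complex.Re (\tr rho) = \sum_i \sum_j weight rho sig i j * eigval rho i.
  rewrite {1}(eigmx_diag pr) mxtrace_mulC mulmxA eigmx_unitary mul1mx mxtrace_diag Re_sum.
  by apply: eq_bigr => i _; rewrite mxE -mulr_suml weight_row mul1r.
have -> : \sum_(k < N) (rat_c R N k * rel_quad (rat_t R N k) rho sig
      - rat_d R k * complex.Re (\tr rho))
    = \sum_i \sum_j weight rho sig i j * rat_log N (eigval rho i) (eigval sig j).
  under [RHS]eq_bigr do under eq_bigr do rewrite mulr_sumr.
  under [RHS]eq_bigr do rewrite exchange_big.
  rewrite [RHS]exchange_big; apply: eq_bigr => k _ /=.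
  rewrite tr1 /rel_quad !mulr_sumr -sumrB; apply: eq_bigr => i _.
  by rewrite !mulr_sumr -sumrB; apply: eq_bigr => j _; ring.
have key i j : weight rho sig i j * (eigval rho i * (ln (eigval rho i) - ln (eigval sig j)))
   <= weight rho sig i j * rat_log N (eigval rho i) (eigval sig j)
   <= weight rho sig i j * (eigval rho i * (ln (eigval rho i) - ln (eigval sig j)))
      + err i j / N%:R.
  have [r0|rn] := eqVneq (eigval rho i) 0.
    rewrite /err r0 ltxx /= !mul0r mulr0 addr0 /rat_log big1 ?mulr0 ?lexx // => k _.
    by rewrite expr0n mul0r mulr0 mulr0 subrr.
  have rp : 0 < eigval rho i by rewrite lt0r rn eigval_ge0.
  have [q0|qn] := eqVneq (eigval sig j) 0.
    have /eqP := weight_support i pr ps pd q0; rewrite mulf_eq0 (negbTE rn) /= => /eqP w0.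
    by rewrite /err w0 !mul0r if_same mul0r addr0 lexx.
  have qp : 0 < eigval sig j by rewrite lt0r qn eigval_ge0.
  have /andP[h1 h2] := rat_log_bounds N0 rp qp.
  rewrite /err rp qp /= -mulrA -mulrDr.
  by rewrite !ler_wpM2l ?sqmod_ge0.
apply/andP; split.
  apply: ler_sum => i _; apply: ler_sum => j _.
  by have /andP[] := key i j.
rewrite mulr_suml -big_split; apply: ler_sum => i _ /=.
rewrite mulr_suml -big_split; apply: ler_sum => j _ /=.
by have /andP[] := key i j.
Qed.

End Pair.

(** * Channels in Kraus form and data processing *)

Section Kraus.
Variables (m n : nat) (Z : finType) (K : Z -> 'M[C]_(n, m)).
Hypothesis K1 : \sum_z adj (K z) *m K z = 1%:M.

Definition kraus (A : 'M[C]_m) : 'M[C]_n := \sum_z K z *m A *m adj (K z).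

Lemma kraus_psd A : psd A -> psd (kraus A).
Proof.
move=> pA; apply: psd_sum => z _; have := psd_conj (adj (K z)) pA.
by rewrite adjK.
Qed.

Lemma krausB A B : kraus (A - B) = kraus A - kraus B.
Proof. by rewrite /kraus -sumrB; apply: eq_bigr => z _; rewrite mulmxBr mulmxBl. Qed.

Lemma kraus_sum (X : finType) (A : X -> 'M[C]_m) : kraus (\sum_x A x) = \sum_x kraus (A x).
Proof.
by rewrite /kraus exchange_big; apply: eq_bigr => z _; rewrite mulmx_sumr mulmx_suml.
Qed.

(** The channel in the Heisenberg picture. *)
Definition kraus_dual (Y : 'M[C]_n) : 'M[C]_m := \sum_z adj (K z) *m Y *m K z.

Lemma adjB p q (A B : 'M[C]_(p, q)) : adj (A - B) = adj A - adj B.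
Proof. by apply/matrixP => ? ?; rewrite !mxE rmorphB. Qed.

Lemma adj_sum (X : finType) p q (A : X -> 'M[C]_(p, q)) :
  adj (\sum_x A x) = \sum_x adj (A x).
Proof.
by apply/matrixP => i j; rewrite !mxE !summxE rmorph_sum; apply: eq_bigr => x _; rewrite !mxE.
Qed.

Lemma tr_kraus A Y : \tr (kraus A *m Y) = \tr (A *m kraus_dual Y).
Proof.
rewrite /kraus /kraus_dual mulmx_suml mulmx_sumr !raddf_sum; apply: eq_bigr => z _ /=.
by rewrite -!mulmxA mxtrace_mulC !mulmxA.
Qed.

Lemma kraus_tr A : \tr (kraus A) = \tr A.
Proof.
rewrite -[kraus A]mulmx1 tr_kraus /kraus_dual; under eq_bigr do rewrite mulmx1.
by rewrite K1 mulmx1.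
Qed.

Lemma kraus_dual_adj Y : adj (kraus_dual Y) = kraus_dual (adj Y).
Proof.
by rewrite /kraus_dual adj_sum; apply: eq_bigr => z _; rewrite !adjM adjK mulmxA.
Qed.

Lemma psd_tr_mul A (B : 'M[C]_(n, m)) : psd A -> 0 <= \tr (A *m (adj B *m B)).
Proof.
move=> pA; rewrite mulmxA mxtrace_mulC mulmxA /mxtrace; apply: sumr_ge0 => i _.
by apply: psd_diag_ge0; have := psd_conj (adj B) pA; rewrite adjK.
Qed.

(* The gap [K*(Y^*Y) - K*(Y)^*K*(Y)] is the sum of the squares of [Y K_z - K_z K*(Y)]. *)
Lemma kraus_schwarz A Y : psd A ->
  complex.Re (\tr (A *m (adj (kraus_dual Y) *m kraus_dual Y)))
    <= complex.Re (\tr (kraus A *m (adj Y *m Y))).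
Proof.
move=> pA; set X := kraus_dual Y.
rewrite tr_kraus -subr_ge0 -Re_opp -Re_add; apply: Re_ge0.
rewrite -raddfB -mulmxBr.
suff -> : kraus_dual (adj Y *m Y) - adj X *m X =
    \sum_z adj (Y *m K z - K z *m X) *m (Y *m K z - K z *m X).
  rewrite mulmx_sumr raddf_sum; apply: sumr_ge0 => z _; exact: psd_tr_mul.
have e1 : \sum_z adj (K z) *m adj Y *m (K z *m X) = adj X *m X.
  by rewrite kraus_dual_adj /kraus_dual mulmx_suml; apply: eq_bigr => z _; rewrite !mulmxA.
have e2 : \sum_z adj X *m adj (K z) *m (Y *m K z) = adj X *m X.
  by rewrite {2}/X /kraus_dual mulmx_sumr; apply: eq_bigr => z _; rewrite !mulmxA.
have e3 : \sum_z adj X *m adj (K z) *m (K z *m X) = adj X *m X.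
  rewrite -[X in _ = _ *m X]mul1mx -K1 mulmx_suml mulmx_sumr.
  by apply: eq_bigr => z _; rewrite !mulmxA.
transitivity (kraus_dual (adj Y *m Y) - (adj X *m X + adj X *m X - adj X *m X)).
  by rewrite addrK.
rewrite -{1}e1 -{1}e2 -e3 -big_split -!sumrB /kraus_dual /=; apply: eq_bigr => z _.
rewrite adjB !adjM mulmxBr !mulmxBl !mulmxA !opprB !opprD !addrA.
by rewrite [LHS]addrAC; congr (_ - _); rewrite addrAC.
Qed.

(** An optimal [Y] for the outputs is pulled back by the dual to a competitor for the inputs. The
    linear term is preserved; [kraus_schwarz] for [Y] controls the [sig] term, and for [adj Y] the
    [rho] term. *)
Lemma relent_kraus (rho sig : 'M[C]_m) : psd rho -> psd sig -> psd (sig - rho) ->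
  relent (kraus rho) (kraus sig) <= relent rho sig.
Proof.
move=> pr ps pd.
have pr' := kraus_psd pr; have ps' := kraus_psd ps.
have pd' : psd (kraus sig - kraus rho) by rewrite -krausB; apply: kraus_psd.
have mono t : 0 <= t ->
    rel_quad t (kraus rho) (kraus sig) <= rel_quad t rho sig.
  move=> t0; have [Y <-] := rel_var_attained t pr' ps'.
  apply: le_trans (rel_var_le (kraus_dual Y) t0 pr ps pd).
  rewrite /rel_var -tr_kraus; apply: lerB; first apply: lerB => //.
    exact: kraus_schwarz.
  apply: ler_wpM2l => //; have := kraus_schwarz (adj Y) pr.
  by rewrite -kraus_dual_adj !adjK.
have [e' he'] := relent_approx pr' ps' pd'; have [e he] := relent_approx pr ps pd.
have bound N : (0 < N)%N -> relent (kraus rho) (kraus sig) <= relent rho sig + e / N%:R.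
  move=> N0; have /andP[/le_trans h1 _] := he' N N0; have /andP[_ h2] := he N N0.
  apply: h1; apply: le_trans h2; apply: ler_sum => k _.
  (* The trace terms agree as traces are preserved, and for [k < N] both [rat_c] and [rat_t] are
     nonnegative, so [mono] applies termwise. *)
  rewrite kraus_tr lerB // ler_wpM2l ?mono // /rat_c /rat_t ?divr_ge0 ?exprn_ge0 //.
  by rewrite subr_ge0 ler_pdivlMr ?ltr0n // mul1r ler_nat.
apply/ler_addgt0Pr => d d0.
pose N := (Num.truncn (`|e| / d)).+1.
have N0 : 0 < N%:R :> R by rewrite ltr0n.
apply: le_trans (bound N isT) _; rewrite lerD2l ler_pdivrMr // mulrC -ler_pdivrMr //.
by apply: le_trans (ltW (truncnS_gt _)); rewrite ler_wpM2r ?invr_ge0 ?(ltW d0) ?ler_norm.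
Qed.

(** The Holevo quantity, for unnormalized operators, is the total relative entropy to their sum [s].
    The cross terms [Tr (A x) ln s] are linear in [A x] and add up to the entropy of [s]; the factor
    [ln 2] converts nats to bits. *)
Lemma relent_sum (p : nat) (X : finType) (A : X -> 'M[C]_p) : (forall x, psd (A x)) ->
  \sum_x relent (A x) (\sum_y A y) =
  ln 2 * (vN_entropy (\sum_x A x) - \sum_x vN_entropy (A x)).
Proof.
move=> pA; set s := \sum_x A x.
have ps : psd s by apply: psd_sum.
have ln2 : ln 2 != 0 :> R by rewrite gt_eqF // ln_gt0 // ltr1n.
have etaE (r : R) : ln 2 * eta r = - (r * ln r).
  rewrite /Defs.eta /log2; have [->|_] := eqVneq r 0; first by rewrite mul0r mulr0 oppr0.
  by field.
have e1 x : relent (A x) s = - (ln 2 * vN_entropy (A x))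
   - \sum_j ln (eigval s j) * complex.Re ((adj (eigmx s) *m A x *m eigmx s) j j).
  have -> : - (ln 2 * vN_entropy (A x)) = \sum_i \sum_j
      weight (A x) s i j * (eigval (A x) i * ln (eigval (A x) i)).
    rewrite /vN_entropy mulr_sumr -sumrN; apply: eq_bigr => i _.
    by rewrite -mulr_suml weight_row mul1r etaE opprK.
  under [X in _ - X]eq_bigr do rewrite diag_eig // mulr_sumr.
  rewrite [X in _ - X]exchange_big -sumrB; apply: eq_bigr => i _.
  by rewrite -sumrB; apply: eq_bigr => j _; ring.
rewrite (eq_bigr _ (fun x _ => e1 x)) sumrB sumrN -mulr_sumr mulrBr addrC; congr (_ - _).
rewrite exchange_big /= /vN_entropy mulr_sumr -sumrN; apply: eq_bigr => j _.
rewrite etaE -mulr_sumr -Re_sum; congr (- _); rewrite mulrC; congr (_ * _).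
have -> : \sum_x (adj (eigmx s) *m A x *m eigmx s) j j = (adj (eigmx s) *m s *m eigmx s) j j.
  by rewrite {4}/s mulmx_sumr mulmx_suml summxE.
by rewrite eigval_conj.
Qed.

Lemma holevo_kraus (X : finType) (A : X -> 'M[C]_m) : (forall x, psd (A x)) ->
  vN_entropy (\sum_x kraus (A x)) - \sum_x vN_entropy (kraus (A x)) <=
  vN_entropy (\sum_x A x) - \sum_x vN_entropy (A x).
Proof.
move=> pA; have ln2 : 0 < ln 2 :> R by rewrite ln_gt0 // ltr1n.
rewrite -(ler_pM2l ln2) -!relent_sum //; last by move=> x; apply: kraus_psd.
apply: ler_sum => x _; rewrite -kraus_sum; apply: relent_kraus => //; first exact: psd_sum.
by rewrite (bigD1 x) //= addrAC subrr add0r; apply: psd_sum.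
Qed.

End Kraus.
End RelativeEntropy.

(** * Linear maps and the Kraus form of a channel *)

Section LinearMaps.
Variable R : realType.
Local Notation C := R[i].
Variables S T : finType.
Variable Phi : op R S -> op R T.
Hypothesis linPhi : linear_map Phi.

Lemma linear_map0 : Phi 0 = 0.
Proof.
have := linPhi 1 0 0; rewrite !scale1r addr0 => /eqP.
by rewrite -subr_eq0 opprD addrA subrr sub0r oppr_eq0 => /eqP.
Qed.

Lemma linear_mapD A B : Phi (A + B) = Phi A + Phi B.
Proof. by have := linPhi 1 A B; rewrite !scale1r. Qed.

Lemma linear_mapZ a A : Phi (a *: A) = a *: Phi A.
Proof. by have := linPhi a A 0; rewrite linear_map0 !addr0. Qed.

Lemma linear_map_sum (X : finType) (P : pred X) (A : X -> op R S) :
  Phi (\sum_(x | P x) A x) = \sum_(x | P x) Phi (A x).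
Proof. by apply: (big_morph Phi linear_mapD linear_map0). Qed.

End LinearMaps.

(* The Kraus operators are read off the eigenvectors of the Choi matrix [J]. *)
Lemma cptp_kraus (R : realType) (S T : finType) (Phi : op R S -> op R T) : cptp Phi ->
  exists (Z : finType) (K : Z -> 'M[R[i]]_(#|T|, #|S|)),
    \sum_z adj (K z) *m K z = 1%:M /\ forall A, Phi A = kraus K A.
Proof.
move=> [lin cp tp].
pose omega (x : 'I_#|S| * S) : R[i] := (enum_rank x.2 == x.1)%:R.
pose J := mkop (fun x y : 'I_#|S| * T => ent (Phi (delta_mx x.1 y.1)) x.2 y.2).
(* [J] is the image under [id (x) Phi] of the projector on the unnormalized maximally entangled
   vector [omega], so complete positivity at [m = #|S|] applies. *)
have psdJ : psd J.
  have := cp _ _ (psd_ket_proj omega).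
  congr psd; apply/op_eqP => x y; rewrite !ent_mkop; congr (ent (Phi _) _ _).
  apply/matrixP => i j; rewrite [LHS]mxE ent_mkop [RHS]mxE /omega /= !enum_valK.
  by rewrite conjC_nat -natrM mulnb.
have [v [_ dJ r0]] := spectral_decomp psdJ.
(* An eigenvector of [J] reshaped into a matrix, scaled by the square root of its eigenvalue. *)
pose K z : 'M[R[i]]_(#|T|, #|S|) :=
  \matrix_(i, j) (toC (Num.sqrt (eigval J z)) * v z (j, enum_val i)).
exists 'I_#|{: 'I_#|S| * T}|, K.
have PhiE A : Phi A = kraus K A.
  rewrite [A in LHS]matrix_sum_delta linear_map_sum // /kraus.
  under eq_bigr do rewrite linear_map_sum //.
  apply/matrixP => i j; rewrite !summxE.
  under eq_bigr do rewrite summxE.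
  under [RHS]eq_bigr do rewrite mxE.
  under [RHS]eq_bigr do under eq_bigr do rewrite mxE mulr_suml.
  under [RHS]eq_bigr do rewrite exchange_big.
  rewrite [RHS]exchange_big; apply: eq_bigr => k _ /=.
  rewrite [RHS]exchange_big; apply: eq_bigr => l _ /=.
  rewrite linear_mapZ // mxE.
  have := dJ (k, enum_val i) (l, enum_val j); rewrite ent_mkop /ent /= !enum_valK => ->.
  rewrite mulr_sumr; apply: eq_bigr => z _.
  rewrite !mxE (rmorphM Num.conj) /= conj_toC.
  rewrite -{1}(sqr_sqrtr (r0 z)) expr2 (rmorphM (@toC R)) /=; ring.
(* Trace preservation on the matrix unit [delta_mx j i] gives the entry [(i, j)] of the Kraus
   sum. *)
split => //; apply/matrixP => i j.
have := tp (delta_mx j i); rewrite PhiE -[kraus _ _]mulmx1 tr_kraus.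
rewrite /kraus_dual; under eq_bigr do rewrite mulmx1.
set M := \sum_z _; rewrite /mxtrace (bigD1 j) //= [X in _ + X = _]big1 ?addr0; last first.
  by move=> k /negbTE kj; rewrite mxE big1 // => l _; rewrite mxE kj mul0r.
rewrite mxE (bigD1 i) //= [X in _ + X = _]big1 ?addr0; last first.
  by move=> l /negbTE li; rewrite mxE li andbF mul0r.
rewrite mxE !eqxx mul1r => ->; rewrite mxE (bigD1 j) //= big1 ?addr0.
  by rewrite mxE eqxx eq_sym.
by move=> k /negbTE kj; rewrite mxE kj.
Qed.

Lemma cptp_psd (R : realType) (S T : finType) (Phi : op R S -> op R T) (A : op R S) :
  cptp Phi -> psd A -> psd (Phi A).
Proof. by move=> /cptp_kraus[Z [K [_ ->]]]; apply: kraus_psd. Qed.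

Lemma holevo_monotone (R : realType) (S T X : finType) (Phi : op R S -> op R T)
    (A : X -> op R S) : cptp Phi -> (forall x, psd (A x)) ->
  vN_entropy (\sum_x Phi (A x)) - \sum_x vN_entropy (Phi (A x)) <=
  vN_entropy (\sum_x A x) - \sum_x vN_entropy (A x).
Proof.
move=> /cptp_kraus[Z [K [K1 PhiE]]] pA.
under eq_bigr do rewrite PhiE; under [X in _ - X <= _]eq_bigr do rewrite PhiE.
exact: holevo_kraus.
Qed.

(** * Encodings from families of positive operators *)

Section Encodings.
Variable R : realType.
Local Notation C := R[i].

Lemma psd_tr_ge0 (n : nat) (A : 'M[C]_n) : psd A -> 0 <= \tr A.
Proof. by move=> pA; apply: sumr_ge0 => i _; apply: psd_diag_ge0. Qed.

Lemma psd_trE (n : nat) (A : 'M[C]_n) : psd A -> toC (complex.Re (\tr A)) = \tr A.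
Proof. by move=> pA; apply: toC_Re; apply: psd_tr_ge0. Qed.

(** The trace is a sum of nonnegative eigenvalues. This settles outcomes of probability zero, which
    cannot be normalized. *)
Lemma psd_tr0 (n : nat) (A : 'M[C]_n) : psd A -> \tr A = 0 -> A = 0.
Proof.
move=> pA; have e := eigmx_diag pA.
rewrite {1}e mxtrace_mulC mulmxA eigmx_unitary mul1mx mxtrace_diag => /eqP.
rewrite psumr_eq0 => [/allP h|i _]; last by rewrite mxE toC_ge0 eigval_ge0.
rewrite e (_ : diag_mx _ = 0) ?mulmx0 ?mul0mx //.
rewrite (_ : \row_i _ = 0) ?linear0 //.
by apply/rowP => i; have /eqP := h i (mem_index_enum i); rewrite !mxE.
Qed.

(** Pulled back along [h], the eigenvectors may lose orthonormality, but a nonnegative combination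
    of rank-one terms stays positive. *)
Lemma psd_relabel (S T : finType) (h : S -> T) (A : op R T) : psd A ->
  psd (mkop (fun x y => ent A (h x) (h y))).
Proof.
move=> pA; have [v [_ dA r0]] := spectral_decomp pA.
by apply: (@psd_eigen _ _ _ _ _ (fun i x => v i (h x)) r0) => s t; rewrite ent_mkop dA.
Qed.

Lemma sum_ord_enum (T : finType) (V : nmodType) (f : T -> V) :
  \sum_(j < #|T|) f (enum_val j) = \sum_x f x.
Proof. by rewrite sum_enum_val; apply: eq_bigr => x _; rewrite enum_rankK. Qed.

Lemma vN_entropy0 (T : finType) : vN_entropy (0 : op R T) = 0.
Proof.
rewrite (@entropy_diag _ _ _ (fun=> 0)) => [|//|x y].
  by rewrite big1 // => x _; rewrite eta0.
by rewrite ent0 rmorph0 mulr0.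
Qed.

Section Family.
Variables (I B X : finType) (b0 : B) (p : I -> R) (A : I -> X -> op R B).
Hypothesis p0 : forall i, 0 <= p i.
Hypothesis pA : forall i x, psd (A i x).
Hypothesis trA : forall i, \sum_x \tr (A i x) = 1.

(* [A i x] plays the role of [p(x|i) omega_{i,x}]; the state attached to an
   outcome of probability zero is irrelevant. *)
Definition family_encoding : encoding R I :=
  @Encoding R I #|B| #|X|
    (fun i j => complex.Re (\tr (A i (enum_val j))))
    (fun i j => if \tr (A i (enum_val j)) == 0 then ket_proj (basis_ket (enum_rank b0))
       else (\tr (A i (enum_val j)))^-1 *:
         mkop (fun x y => ent (A i (enum_val j)) (enum_val x) (enum_val y))).

Local Notation E := family_encoding.

Lemma tr_relabel (M : op R B) :
  \tr (mkop (fun x y : 'I_#|B| => ent M (enum_val x) (enum_val y))) = \tr M.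
Proof.
rewrite !tr_ent; under eq_bigr do rewrite ent_mkop.
exact: (sum_ord_enum (fun x => ent M x x)).
Qed.

Lemma family_encoding_valid : valid_encoding E.
Proof.
move=> i; split=> [j||j] /=.
- by apply: Re_ge0; apply: psd_tr_ge0.
- by rewrite (sum_ord_enum (fun x => complex.Re (\tr (A i x)))) -Re_sum trA.
- case: eqVneq => [_|t0]; split.
  + exact: psd_ket_proj.
  + rewrite tr_ent (bigD1 (enum_rank b0)) //= ent_mkop /basis_ket eqxx conjC1 mulr1.
    by rewrite big1 ?addr0 // => k /negbTE kb; rewrite ent_mkop kb mul0r.
  + have t1 : 0 <= complex.Re (\tr (A i (enum_val j)))^-1.
      by apply: Re_ge0; rewrite invr_ge0 psd_tr_ge0.
    have := psdZ t1 (psd_relabel (@enum_val B xpredT) (pA i (enum_val j))).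
    by rewrite toC_Re // invr_ge0 psd_tr_ge0.
  + by rewrite mxtraceZ tr_relabel mulVf.
Qed.

(** The probability cancels the normalization. Where the trace is zero, [A i x] is itself zero, so
    the placeholder state leaves no mark. *)
Lemma enc_stateE i x y : ent (enc_state E i) x y =
  (x.2 == y.2)%:R * ent (A i (enum_val x.2)) (enum_val x.1) (enum_val y.1).
Proof.
have key j (a b : 'I_#|B|) : toC (@enc_p R I E i j) * ent (@enc_om R I E i j) a b =
    ent (A i (enum_val j)) (enum_val a) (enum_val b).
  rewrite /= psd_trE //; case: eqVneq => [t0|t0].
    by rewrite t0 mul0r (psd_tr0 (pA i (enum_val j)) t0) ent0.
  by rewrite entZ ent_mkop mulrA mulfV // mul1r.
rewrite /enc_state ent_sum.
under eq_bigr => j _.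
  rewrite entZ ent_mkop mulrA key ent_mkop /basis_ket conjC_nat mulrCA.
  over.
rewrite sum_delta mulrC; congr (_ * _).
by rewrite eq_sym.
Qed.

Lemma rhoABC_E x y : ent (rhoABC p E) x y =
  ((x.1 == y.1) && (x.2.2 == y.2.2))%:R *
  (toC (p x.1) * ent (A x.1 (enum_val x.2.2)) (enum_val x.2.1) (enum_val y.2.1)).
Proof.
rewrite /rhoABC ent_sum.
under eq_bigr => i _.
  rewrite entZ ent_mkop ent_mkop /basis_ket conjC_nat -!mulrA mulrCA.
  over.
rewrite (sum_delta x.1 (fun i => toC (p i) * ((y.1 == i)%:R * ent (enc_state E i) x.2 y.2))).
by rewrite enc_stateE -mulnb natrM eq_sym; ring.
Qed.

Lemma p_psd i x : psd (toC (p i) *: A i x).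
Proof. exact: psdZ. Qed.

Lemma entropy_ABC : vN_entropy (rhoABC p E) = \sum_i \sum_x vN_entropy (toC (p i) *: A i x).
Proof.
pose h (z : I * ('I_#|B| * 'I_#|X|)) : (I * X) * B :=
  ((z.1, enum_val z.2.2), enum_val z.2.1).
rewrite pair_bigA.
have bh : bijective h.
  exists (fun z => (z.1.1, (enum_rank z.2, enum_rank z.1.2))).
    by move=> [i [b c]]; rewrite /h /= !enum_valK.
  by move=> [[i x] b]; rewrite /h /= !enum_rankK.
have [] // := entropy_block (A := rhoABC p E) (B := fun z => toC (p z.1) *: A z.1 z.2) bh.
  by move=> z; apply: p_psd.
by move=> x y; rewrite rhoABC_E /h /= xpair_eqE (inj_eq enum_val_inj) entZ.
Qed.

Lemma rhoBC_E x y : ent (rhoBC p E) x y = (x.2 == y.2)%:R *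
  ent (\sum_i toC (p i) *: A i (enum_val x.2)) (enum_val x.1) (enum_val y.1).
Proof.
rewrite /rhoBC ent_mkop ent_sum mulr_sumr; apply: eq_bigr => i _.
by rewrite rhoABC_E /= eqxx entZ.
Qed.

Lemma entropy_BC : vN_entropy (rhoBC p E) = \sum_x vN_entropy (\sum_i toC (p i) *: A i x).
Proof.
pose h (z : 'I_#|B| * 'I_#|X|) : X * B := (enum_val z.2, enum_val z.1).
have bh : bijective h.
  exists (fun z => (enum_rank z.2, enum_rank z.1)).
    by move=> [b c]; rewrite /h /= !enum_valK.
  by move=> [x b]; rewrite /h /= !enum_rankK.
have [] // := entropy_block (A := rhoBC p E) (B := fun x => \sum_i toC (p i) *: A i x) bh.
  by move=> x; apply: psd_sum => i _; apply: p_psd.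
by move=> x y; rewrite rhoBC_E /h /= (inj_eq enum_val_inj).
Qed.

Definition joint i x : R := p i * complex.Re (\tr (A i x)).

Lemma joint_ge0 i x : 0 <= joint i x.
Proof. by rewrite mulr_ge0 //; apply/Re_ge0/psd_tr_ge0. Qed.

Lemma toC_joint i x : toC (joint i x) = toC (p i) * \tr (A i x).
Proof. by rewrite rmorphM /= psd_trE. Qed.

Lemma joint_marginal i : \sum_x joint i x = p i.
Proof. by rewrite -mulr_sumr -Re_sum trA mulr1. Qed.

Lemma entropy_A : vN_entropy (rhoA p E) = \sum_i eta (p i).
Proof.
apply: entropy_diag => // i j; rewrite ent_mkop.
under eq_bigr do rewrite rhoABC_E /= eqxx andbT.
rewrite -mulr_sumr -mulr_sumr; congr (_ * _).
rewrite -[RHS]mulr1 -(trA i); congr (_ * _).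
rewrite -(pair_bigA _ (fun b c => ent (A i (enum_val c)) (enum_val b) (enum_val b))) /=.
rewrite exchange_big (sum_ord_enum (fun x => \sum_b ent (A i x) (enum_val b) (enum_val b))).
by apply: eq_bigr => x _; rewrite tr_ent (sum_ord_enum (fun b => ent (A i x) b b)).
Qed.

Lemma entropy_C : vN_entropy (rhoC p E) = \sum_x eta (\sum_i joint i x).
Proof.
rewrite -(sum_ord_enum (fun x => eta (\sum_i joint i x))).
apply: entropy_diag => [c|c c']; first by apply: sumr_ge0 => i _; apply: joint_ge0.
rewrite ent_mkop; under eq_bigr do rewrite rhoBC_E /=.
rewrite -mulr_sumr; congr (_ * _).
rewrite (sum_ord_enum (fun b => ent (\sum_i toC (p i) *: A i (enum_val c)) b b)) -tr_ent.
rewrite (raddf_sum (@mxtrace _ _)) (raddf_sum (@toC R)); apply: eq_bigr => i _ /=.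
by rewrite mxtraceZ toC_joint.
Qed.

Lemma entropy_AC : vN_entropy (rhoAC p E) = \sum_i \sum_x eta (joint i x).
Proof.
rewrite pair_bigA /=.
transitivity (\sum_(z : I * 'I_#|X|) eta (joint z.1 (enum_val z.2))).
  apply: entropy_diag => [z|z z']; first exact: joint_ge0.
  rewrite ent_mkop; under eq_bigr do rewrite rhoABC_E /=.
  rewrite -mulr_sumr -mulr_sumr toC_joint.
  by rewrite (sum_ord_enum (fun b => ent (A z.1 (enum_val z.2)) b b)) -tr_ent.
rewrite -(pair_bigA _ (fun i c => eta (joint i (enum_val c)))) /=.
rewrite -(pair_bigA _ (fun i x => eta (joint i x))) /=.
by apply: eq_bigr => i _; rewrite (sum_ord_enum (fun x => eta (joint i x))).
Qed.

Lemma family_SAC : SAC p E =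
  \sum_i eta (p i) + \sum_x eta (\sum_i joint i x) - \sum_i \sum_x eta (joint i x).
Proof. by rewrite /SAC entropy_A entropy_C entropy_AC. Qed.

(** The chain rule [S(A:BC) = S(A:C) + S(A:B|C)]; the terms before [SAC] are the total information
    [S(A:BC)]. *)
Lemma family_SABgC : SABgC p E =
  \sum_i eta (p i) + \sum_x vN_entropy (\sum_i toC (p i) *: A i x)
  - \sum_i \sum_x vN_entropy (toC (p i) *: A i x) - SAC p E.
Proof.
rewrite /SABgC entropy_ABC entropy_BC family_SAC entropy_C entropy_AC; ring.
Qed.

End Family.
End Encodings.

(** * Random erasure of the classical register *)

Section Erasure.
Variable R : realType.
Local Notation C := R[i].

Lemma sum_option (V : nmodType) (X : finType) (f : option X -> V) :
  \sum_c f c = f None + \sum_x f (Some x).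
Proof.
rewrite (bigD1 None) //=; congr (_ + _).
rewrite (reindex_omap Some id) //=; last by case.
by apply: eq_bigl => x; rewrite eqxx.
Qed.

Section Flag.
Variables F L : finType.
Implicit Types M : L -> op R F.

(** The classical-quantum operator [sum_l M_l (x) |l><l|]. *)
Definition flag M : op R (F * L)%type :=
  mkop (fun x y => (x.2 == y.2)%:R * ent (M x.2) x.1 y.1).

Definition single (l : L) (A : op R F) (l' : L) : op R F := (l == l')%:R *: A.

Lemma flag_entropy M : (forall l, psd (M l)) ->
  psd (flag M) /\ vN_entropy (flag M) = \sum_l vN_entropy (M l).
Proof.
move=> pM; pose h (x : F * L) := (x.2, x.1).
apply: (@entropy_block _ _ _ _ h) => //.
  by exists (fun x => (x.2, x.1)) => -[].
by move=> x y; rewrite ent_mkop.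
Qed.

Lemma flagZ c M : flag (fun l => c *: M l) = c *: flag M.
Proof. by apply/op_eqP => x y; rewrite entZ !ent_mkop entZ mulrCA. Qed.

Lemma flag_sum (X : finType) (M : X -> L -> op R F) :
  flag (fun l => \sum_x M x l) = \sum_x flag (M x).
Proof.
apply/op_eqP => x y; rewrite ent_sum ent_mkop ent_sum mulr_sumr.
by apply: eq_bigr => z _; rewrite ent_mkop.
Qed.

Lemma tr_flag M : \tr (flag M) = \sum_l \tr (M l).
Proof.
rewrite tr_ent; transitivity (\sum_x \sum_l ent (flag M) (x, l) (x, l)).
  by rewrite pair_bigA; apply: eq_bigr => -[].
rewrite exchange_big /=.
apply: eq_bigr => l _; rewrite tr_ent; apply: eq_bigr => x _.
by rewrite ent_mkop eqxx mul1r.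
Qed.

Lemma singleZ c l A : single l (c *: A) = fun l' => c *: single l A l'.
Proof. by apply/funext => l'; rewrite /single !scalerA mulrC. Qed.

Lemma single_sum (X : finType) l (A : X -> op R F) :
  single l (\sum_x A x) = fun l' => \sum_x single l (A x) l'.
Proof. by apply/funext => l'; rewrite /single scaler_sumr. Qed.

Lemma flag_single l A : psd A ->
  psd (flag (single l A)) /\ vN_entropy (flag (single l A)) = vN_entropy A.
Proof.
move=> pA; have ps l' : psd (single l A l').
  by rewrite /single; case: eqP => _; rewrite ?scale1r ?scale0r //; apply: psd0.
have [pf ->] := flag_entropy ps.
split=> //; rewrite (bigD1 l) //= big1 ?addr0 /single ?eqxx ?scale1r // => l' /negbTE.
by rewrite eq_sym => ->; rewrite scale0r vN_entropy0.
Qed.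

Lemma tr_flag_single l A : \tr (flag (single l A)) = \tr A.
Proof.
rewrite tr_flag (bigD1 l) //= big1 ?addr0 /single ?eqxx ?scale1r // => l' /negbTE.
by rewrite eq_sym => ->; rewrite scale0r mxtrace0.
Qed.

End Flag.

Section Erased.
Variables (I F L : finType) (p : I -> R) (B : I -> L -> op R F) (q : R).
Hypothesis p0 : forall i, 0 <= p i.
Hypothesis p1 : \sum_i p i = 1.
Hypothesis pB : forall i l, psd (B i l).
Hypothesis trB : forall i, \sum_l \tr (B i l) = 1.
Hypothesis q01 : 0 <= q <= 1.

(* The label always travels in the quantum register, and a copy survives in the
   classical register with probability [q]: this scales the classical
   information by [q] and leaves the total information unchanged. *)
Definition erased (i : I) (c : option L) : op R (F * L)%type :=
  if c is Some l then toC q *: flag (single l (B i l)) else toC (1 - q) *: flag (B i).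

Let q0 : 0 <= q. Proof. by have /andP[] := q01. Qed.
Let q1 : 0 <= 1 - q. Proof. by rewrite subr_ge0; have /andP[] := q01. Qed.

Lemma erased_psd i c : psd (erased i c).
Proof.
case: c => [l|]; apply: psdZ => //; first by have [] := flag_single l (pB i l).
by have [] := flag_entropy (pB i).
Qed.

Lemma erased_tr i : \sum_c \tr (erased i c) = 1.
Proof.
rewrite sum_option /= mxtraceZ tr_flag trB.
under eq_bigr do rewrite mxtraceZ tr_flag_single.
by rewrite -mulr_sumr trB !mulr1 -rmorphD subrK rmorph1.
Qed.

Lemma scaleC_comm (n : nat) (a b : C) (A : 'M[C]_n) : a *: (b *: A) = b *: (a *: A).
Proof. by rewrite !scalerA mulrC. Qed.

(** Erasure adds the binary entropy of [q] times the total trace. That term is linear in [M], so it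
    cancels between the two sides of [erased_total]. *)
Lemma erased_entropy (M : L -> op R F) : (forall l, psd (M l)) ->
  vN_entropy (toC (1 - q) *: flag M) + \sum_l vN_entropy (toC q *: flag (single l (M l)))
  = \sum_l vN_entropy (M l) + (eta (1 - q) + eta q) * \sum_l complex.Re (\tr (M l)).
Proof.
move=> pM; have [pf ef] := flag_entropy pM.
rewrite entropyZ // ef tr_flag Re_sum.
have e l : vN_entropy (toC q *: flag (single l (M l))) =
    q * vN_entropy (M l) + eta q * complex.Re (\tr (M l)).
  by have [pfl efl] := flag_single l (pM l); rewrite entropyZ // efl tr_flag_single.
rewrite (eq_bigr _ (fun l _ => e l)) big_split /= -!mulr_sumr; ring.
Qed.

Lemma erased_sum c : \sum_i toC (p i) *: erased i c =
  if c is Some l then toC q *: flag (single l (\sum_i toC (p i) *: B i l))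
  else toC (1 - q) *: flag (fun l => \sum_i toC (p i) *: B i l).
Proof.
case: c => [l|] /=.
  rewrite single_sum flag_sum scaler_sumr; apply: eq_bigr => i _.
  by rewrite singleZ flagZ scaleC_comm.
rewrite flag_sum scaler_sumr; apply: eq_bigr => i _.
by rewrite flagZ scaleC_comm.
Qed.

Lemma erased_total : \sum_c vN_entropy (\sum_i toC (p i) *: erased i c)
    - \sum_i \sum_c vN_entropy (toC (p i) *: erased i c)
  = \sum_l vN_entropy (\sum_i toC (p i) *: B i l)
    - \sum_i \sum_l vN_entropy (toC (p i) *: B i l).
Proof.
have pM i l : psd (toC (p i) *: B i l) by apply: psdZ.
have pS l : psd (\sum_i toC (p i) *: B i l) by apply: psd_sum.
have tr_i i : \sum_l complex.Re (\tr (toC (p i) *: B i l)) = p i.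
  under eq_bigr do rewrite mxtraceZ Re_toCM.
  by rewrite -mulr_sumr -Re_sum trB mulr1.
under eq_bigr do rewrite erased_sum.
rewrite sum_option erased_entropy //.
have e i : \sum_c vN_entropy (toC (p i) *: erased i c) =
    \sum_l vN_entropy (toC (p i) *: B i l) + (eta (1 - q) + eta q) * p i.
  rewrite sum_option /= scaleC_comm -flagZ.
  under eq_bigr do rewrite scaleC_comm -flagZ -singleZ.
  by rewrite erased_entropy // tr_i.
rewrite [X in _ - X](eq_bigr _ (fun i _ => e i)) big_split /= -mulr_sumr p1.
under [X in _ + _ * X - _]eq_bigr do rewrite (raddf_sum (@mxtrace _ _)) Re_sum.
rewrite [X in _ + _ * X - _]exchange_big /=.
under [X in _ + _ * X - _]eq_bigr do rewrite tr_i.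
by rewrite p1; ring.
Qed.

(** The outcome [None] is independent of [i] and carries no information; the outcomes [Some l]
    reproduce the original joint distribution with weight [q]. *)
Lemma erased_classical :
  \sum_i eta (p i) + \sum_c eta (\sum_i joint p erased i c)
    - \sum_i \sum_c eta (joint p erased i c)
  = q * (\sum_i eta (p i) + \sum_l eta (\sum_i joint p B i l)
    - \sum_i \sum_l eta (joint p B i l)).
Proof.
have jN i : joint p erased i None = (1 - q) * p i.
  by rewrite /joint /= mxtraceZ tr_flag trB mulr1 Re_toC mulrC.
have jS i l : joint p erased i (Some l) = q * joint p B i l.
  by rewrite /joint /= mxtraceZ tr_flag_single Re_toCM mulrCA.
have j0 i l : 0 <= joint p B i l by apply: joint_ge0.
have jm i : \sum_l joint p B i l = p i by apply: joint_marginal.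
have jNs : \sum_i joint p erased i None = 1 - q.
  by under eq_bigr do rewrite jN; rewrite -mulr_sumr p1 mulr1.
rewrite sum_option jNs.
under [\sum_l eta (\sum_i joint p erased i (Some l))]eq_bigr => l _.
  under eq_bigr do rewrite jS.
  rewrite -mulr_sumr etaM ?sumr_ge0 //; over.
rewrite big_split /= -!mulr_sumr.
have e i : \sum_c eta (joint p erased i c) = (1 - q) * eta (p i) + eta (1 - q) * p i
    + (q * \sum_l eta (joint p B i l) + eta q * p i).
  rewrite sum_option jN etaM //; congr (_ + _).
  under eq_bigr do rewrite jS etaM //.
  by rewrite big_split /= -2!mulr_sumr jm.
rewrite [X in _ - X](eq_bigr _ (fun i _ => e i)) !big_split /= -!mulr_sumr p1.
have -> : \sum_l \sum_i joint p B i l = 1.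
  by rewrite exchange_big -p1; apply: eq_bigr => i _; apply: jm.
ring.
Qed.

End Erased.
End Erasure.

(** * Single-letter reduction *)

Lemma sum_pair (V : nmodType) (S T : finType) (f : S * T -> V) :
  \sum_z f z = \sum_x \sum_y f (x, y).
Proof. by rewrite pair_bigA; apply: eq_bigr => -[]. Qed.

(** * Sequences with one letter replaced, and their prefixes *)

Section Sequences.
Variables (n : nat) (X : finType).
Implicit Types (f : {ffun 'I_n -> X}) (k : 'I_n).

Definition upd f k (a : X) : {ffun 'I_n -> X} :=
  [ffun l => if l == k then a else f l].

Lemma upd_same f k a : upd f k a k = a.
Proof. by rewrite ffunE eqxx. Qed.

Lemma upd_upd f k a b : upd (upd f k a) k b = upd f k b.
Proof. by apply/ffunP => l; rewrite !ffunE; case: eqP. Qed.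

Lemma upd_id f k : upd f k (f k) = f.
Proof. by apply/ffunP => l; rewrite !ffunE; case: eqP => // ->. Qed.

(** Updating position [k] is a bijection between two fibers. The letter [a0] acts as a dummy:
    sequences with [f k = a0] stand for assignments of the remaining letters. *)
Lemma sum_upd (V : nmodType) k (a a0 : X) (G : {ffun 'I_n -> X} -> V) :
  \sum_(f : {ffun 'I_n -> X} | f k == a0) G (upd f k a) =
  \sum_(f : {ffun 'I_n -> X} | f k == a) G f.
Proof.
rewrite [RHS](reindex_onto (fun f => upd f k a) (fun f => upd f k a0)) /=.
  apply: eq_bigl => f; rewrite upd_same eqxx upd_upd /=.
  by apply/eqP/eqP => [<-|<-]; rewrite ?upd_id ?upd_same.
by move=> f /eqP <-; rewrite upd_upd upd_id.
Qed.

Lemma sum_upd_all (V : nmodType) k (a0 : X) (G : {ffun 'I_n -> X} -> V) :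
  \sum_a \sum_(f : {ffun 'I_n -> X} | f k == a0) G (upd f k a) =
  \sum_(f : {ffun 'I_n -> X}) G f.
Proof.
rewrite [RHS](partition_big (fun f : {ffun 'I_n -> X} => f k) predT) //=.
by apply: eq_bigr => a _; rewrite sum_upd.
Qed.

(** Masking by [None] keeps prefixes of all lengths in one finite type, as a register label
    requires. The letter at position [k] is itself masked. *)
Definition seq_prefix (k : nat) f : {ffun 'I_n -> option X} :=
  [ffun l : 'I_n => if (l < k)%N then Some (f l) else None].

Lemma seq_prefix_eqP (k : nat) f g :
  seq_prefix k f = seq_prefix k g <-> forall l : 'I_n, (l < k)%N -> f l = g l.
Proof.
split=> [/ffunP h l lk|h].
  by have := h l; rewrite !ffunE lk => -[].
by apply/ffunP => l; rewrite !ffunE; case: ifP => // /h ->.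
Qed.

Lemma seq_prefix_upd k f a : seq_prefix k (upd f k a) = seq_prefix k f.
Proof.
apply/seq_prefix_eqP => l lk; rewrite ffunE; case: eqP => // lk'.
by rewrite lk' ltnn in lk.
Qed.

End Sequences.

(** The sum sees [f] only through its partition into nonempty fibers; an empty fiber contributes
    [Phi 0 = 0]. *)
Lemma fiber_sum_classes (V : nmodType) (W : zmodType) (Phi : V -> W) (T X : finType)
    (f : T -> X) (G : T -> V) : Phi 0 = 0 ->
  \sum_a Phi (\sum_(x | f x == a) G x) =
  \sum_(D in [set [set x | f x == f y] | y : T]) Phi (\sum_(x in D) G x).
Proof.
move=> Phi0; pose cls a := [set x | f x == a].
have -> : [set [set x | f x == f y] | y : T] = cls @: ([set f y | y : T]).
  by rewrite -imset_comp; apply: eq_imset.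
rewrite big_imset /=; last first.
  move=> _ b /imsetP[y _ ->] _ /setP /(_ y); rewrite !inE eqxx => /esym/eqP //.
rewrite (bigID (mem ([set f y | y : T]))) /= [X in _ + X]big1 ?addr0.
  by apply: eq_bigr => a _; congr Phi; apply: eq_bigl => x; rewrite inE.
move=> a na; rewrite big1 // => x /eqP fx.
by rewrite -fx imset_f // in na.
Qed.

Lemma fiber_sum_eq (V : nmodType) (W : zmodType) (Phi : V -> W) (T X Y : finType)
    (f : T -> X) (h : T -> Y) (G : T -> V) : Phi 0 = 0 ->
  (forall x y, f x = f y <-> h x = h y) ->
  \sum_a Phi (\sum_(x | f x == a) G x) = \sum_b Phi (\sum_(x | h x == b) G x).
Proof.
move=> Phi0 fh; rewrite !fiber_sum_classes //; apply: eq_bigl => D.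
suff -> : [set [set x | f x == f y] | y : T] = [set [set x | h x == h y] | y : T] by [].
apply: eq_imset => y; apply/setP => x; rewrite !inE.
by apply/eqP/eqP => /fh.
Qed.

(** * The chain rule over the letters of a random sequence *)

Section Telescope.
Variable R : realType.
Local Notation C := R[i].
Variables (n : nat) (I J F : finType) (p : I -> R).
Hypothesis n0 : (0 < n)%N.
Hypothesis p0 : forall i, 0 <= p i.
Hypothesis p1 : \sum_i p i = 1.

Lemma prob_seq_ge0 (K : {ffun 'I_n -> I}) : 0 <= prob_seq p K.
Proof. exact: prodr_ge0. Qed.

Lemma prob_seq_sum : \sum_(K : {ffun 'I_n -> I}) prob_seq p K = 1.
Proof.
rewrite -(bigA_distr_bigA (fun (_ : 'I_n) i => p i)) /=.
by rewrite big1.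
Qed.

(** By independence, restricting to [K k = i] amounts to overwriting the [k]-th letter by [i] at the
    price [p i], even when [p i = 0]. *)
Lemma prob_seq_resample (V : lmodType C) (k : 'I_n) i (G : {ffun 'I_n -> I} -> V) :
  \sum_(K : {ffun 'I_n -> I} | K k == i) toC (prob_seq p K) *: G K
  = toC (p i) *: \sum_(K : {ffun 'I_n -> I}) toC (prob_seq p K) *: G (upd K k i).
Proof.
(* Here [i] is also the dummy letter: every sequence on the right is some [upd K k a] with
   [K k = i], and the weights [p a] sum to [1]. *)
rewrite -(sum_upd_all k i) exchange_big /= scaler_sumr.
apply: eq_bigr => K /eqP Kk.
have PE a : prob_seq p (upd K k a) = p a * \prod_(l | l != k) p (K l).
  rewrite /prob_seq (bigD1 k) //= upd_same; congr (_ * _).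
  by apply: eq_bigr => l /negbTE lk; rewrite ffunE lk.
under eq_bigr do rewrite upd_upd -[in G _]Kk upd_id PE rmorphM -scalerA.
rewrite -scaler_suml -(rmorph_sum (@toC R)) p1 rmorph1 scale1r scalerA -rmorphM.
by rewrite -PE -Kk upd_id.
Qed.

Variable M : {ffun 'I_n -> I} -> J -> op R F.
Hypothesis pM : forall K j, psd (M K j).
Hypothesis trM : forall K, \sum_j \tr (M K j) = 1.

Definition label : finType := ('I_n * {ffun 'I_n -> option I} * J)%type.

Definition weighted (K : {ffun 'I_n -> I}) (j : J) : op R F := toC (prob_seq p K) *: M K j.

(* Inserting [i] at position [k] of an independent random sequence, instead of
   conditioning on the [k]-th letter, avoids dividing by [p i]. *)
Definition letter_family (i : I) (l : label) : op R F :=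
  toC (n%:R^-1 : R) *: \sum_(K : {ffun 'I_n -> I} | seq_prefix l.1.1 K == l.1.2)
     toC (prob_seq p K) *: M (upd K l.1.1 i) l.2.

Lemma weighted_psd K j : psd (weighted K j).
Proof. by apply: psdZ => //; apply: prob_seq_ge0. Qed.

Lemma letter_psd i l : psd (letter_family i l).
Proof.
apply: psdZ; first by rewrite invr_ge0.
by apply: psd_sum => K _; apply: psdZ => //; apply: prob_seq_ge0.
Qed.

Lemma sum_label (V : nmodType) (f : label -> V) :
  \sum_l f l = \sum_k \sum_g \sum_j f (k, g, j).
Proof.
by rewrite !sum_pair.
Qed.

Lemma weighted_tr : \sum_K \sum_j complex.Re (\tr (weighted K j)) = 1.
Proof.
rewrite -[RHS]prob_seq_sum; apply: eq_bigr => K _.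
rewrite -Re_sum; under eq_bigr do rewrite mxtraceZ.
by rewrite -mulr_sumr trM mulr1.
Qed.

Lemma letter_tr i : \sum_l \tr (letter_family i l) = 1.
Proof.
rewrite sum_label.
transitivity (\sum_(k < n) toC (n%:R^-1 : R)).
  apply: eq_bigr => k _; rewrite exchange_big /=.
  under eq_bigr do under eq_bigr do rewrite mxtraceZ (raddf_sum (@mxtrace _ _)) /=.
  under eq_bigr do rewrite -mulr_sumr.
  rewrite -mulr_sumr -[RHS]mulr1; congr (_ * _).
  rewrite -[RHS](rmorph1 (@toC R)) -prob_seq_sum rmorph_sum /=.
  transitivity (\sum_j \sum_(K : {ffun 'I_n -> I}) toC (prob_seq p K) * \tr (M (upd K k i) j)).
    apply: eq_bigr => j _; rewrite [RHS](partition_big (seq_prefix k) predT) //=.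
    by apply: eq_bigr => g _; apply: eq_bigr => K _; rewrite mxtraceZ.
  rewrite exchange_big; apply: eq_bigr => K _ /=.
  by rewrite -mulr_sumr trM mulr1.
rewrite sumr_const card_ord fmorphV rmorph_nat -(mulr_natl (n%:R^-1 : C)) mulfV //.
by rewrite pnatr_eq0 -lt0n.
Qed.

(** The weight [p i] turns the inserted letter back into a genuine letter of the random sequence. *)
Lemma letter_scaled i l : toC (p i) *: letter_family i l =
  toC (n%:R^-1 : R) *: \sum_(K : {ffun 'I_n -> I} | (seq_prefix l.1.1 K == l.1.2) && (K l.1.1 == i))
     weighted K l.2.
Proof.
rewrite /letter_family scaleC_comm; congr (_ *: _).
have := prob_seq_resample l.1.1 i
  (fun K => if seq_prefix l.1.1 K == l.1.2 then M K l.2 else 0).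
under [in RHS]eq_bigr do rewrite seq_prefix_upd (fun_if (GRing.scale _)) scaler0.
rewrite -big_mkcond => <-; rewrite [RHS]big_mkcondl /=.
by apply: eq_bigr => K _; rewrite (fun_if (GRing.scale _)) scaler0.
Qed.

Lemma letter_marginal l : \sum_i toC (p i) *: letter_family i l =
  toC (n%:R^-1 : R) *: \sum_(K : {ffun 'I_n -> I} | seq_prefix l.1.1 K == l.1.2) weighted K l.2.
Proof.
under eq_bigr do rewrite letter_scaled.
rewrite -scaler_sumr; congr (_ *: _).
by rewrite [RHS](partition_big (fun K : {ffun 'I_n -> I} => K l.1.1) predT).
Qed.

Section Functional.
Variable Phi : op R F -> R.
Hypothesis Phi0 : Phi 0 = 0.
Hypothesis PhiZ : forall c A, 0 <= c -> psd A ->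
  Phi (toC c *: A) = c * Phi A + eta c * complex.Re (\tr A).

(** The joint entropy, as measured by [Phi], of the outputs and the first [k] letters. *)
Let Q (k : nat) : R :=
  \sum_j \sum_g Phi (\sum_(K : {ffun 'I_n -> I} | seq_prefix k K == g) weighted K j).

Let wsum_psd (P : pred {ffun 'I_n -> I}) j : psd (\sum_(K | P K) weighted K j).
Proof. by apply: psd_sum => K _; apply: weighted_psd. Qed.

Let Q_marginal : \sum_l Phi (\sum_i toC (p i) *: letter_family i l) =
  \sum_(k < n) (n%:R^-1 * Q k + eta n%:R^-1).
Proof.
rewrite sum_label; apply: eq_bigr => k _; rewrite exchange_big /=.
under eq_bigr do under eq_bigr do rewrite letter_marginal PhiZ ?invr_ge0 //=.
under eq_bigr do rewrite big_split /= -!mulr_sumr.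
rewrite big_split /= -!mulr_sumr; congr (_ + _).
rewrite -[RHS]mulr1; congr (_ * _); rewrite -[RHS]weighted_tr [RHS]exchange_big /=.
apply: eq_bigr => j _; rewrite [RHS](partition_big (seq_prefix k) predT) //=.
by apply: eq_bigr => g _; rewrite (raddf_sum (@mxtrace _ _)) Re_sum.
Qed.

Let Q_joint : \sum_i \sum_l Phi (toC (p i) *: letter_family i l) =
  \sum_(k < n) (n%:R^-1 * Q k.+1 + eta n%:R^-1).
Proof.
under eq_bigr do rewrite sum_label.
rewrite exchange_big; apply: eq_bigr => k _ /=.
transitivity (\sum_j \sum_(z : I * {ffun 'I_n -> option I})
   Phi (toC (n%:R^-1 : R) *: \sum_(K : {ffun 'I_n -> I} | (K k, seq_prefix k K) == z) weighted K j)).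
  under [RHS]eq_bigr do rewrite sum_pair.
  rewrite [RHS]exchange_big; apply: eq_bigr => i _ /=.
  rewrite exchange_big; apply: eq_bigr => j _; apply: eq_bigr => g _ /=.
  rewrite letter_scaled; congr (Phi (_ *: _)); apply: eq_bigl => K.
  by rewrite xpair_eqE andbC.
under eq_bigr do under eq_bigr do rewrite PhiZ ?invr_ge0 //=.
under eq_bigr do rewrite big_split /= -!mulr_sumr.
rewrite big_split /= -!mulr_sumr; congr (_ * _ + _).
  (* Letter [k] together with the letters before it determines the same partition as the first
     [k.+1] letters. *)
  apply: eq_bigr => j _; apply: fiber_sum_eq => // K K'; split.
    move=> [Kk /seq_prefix_eqP h]; apply/seq_prefix_eqP => l.
    rewrite ltnS leq_eqVlt => /orP[/eqP/val_inj -> //|]; exact: h.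
  move/seq_prefix_eqP => h; rewrite h //; congr pair; apply/seq_prefix_eqP => l lk.
  by apply: h; rewrite ltnS ltnW.
rewrite -[RHS]mulr1; congr (_ * _); rewrite -[RHS]weighted_tr [RHS]exchange_big /=.
apply: eq_bigr => j _.
rewrite [RHS](partition_big (fun K : {ffun 'I_n -> I} => (K k, seq_prefix k K)) predT) //=.
by apply: eq_bigr => g _; rewrite (raddf_sum (@mxtrace _ _)) Re_sum.
Qed.

(** Revealing letter [k] moves [Q k] to [Q k.+1], and the terms [eta n^-1] of the uniform position
    cancel. [Phi] is abstract in order to cover both the von Neumann entropy, for the total
    information, and [eta] of the trace, for the classical one. *)
Lemma letter_telescope :
  n%:R * (\sum_l Phi (\sum_i toC (p i) *: letter_family i l)
    - \sum_i \sum_l Phi (toC (p i) *: letter_family i l))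
  = \sum_j Phi (\sum_K weighted K j) - \sum_K \sum_j Phi (weighted K j).
Proof.
rewrite Q_marginal Q_joint -sumrB.
rewrite (eq_bigr (fun k : 'I_n => n%:R^-1 * (Q k - Q k.+1))); last by move=> k _; ring.
rewrite -mulr_sumr mulrA mulfV ?mul1r ?pnatr_eq0 -?lt0n //.
rewrite -(big_mkord predT (fun k => Q k - Q k.+1)).
rewrite (@telescope_sumr_eq _ _ _ (fun k => - Q k)) //; last by move=> k _; ring.
rewrite opprK addrC; congr (_ - _).
  (* The empty prefix has a single fiber; further down, the prefix of length [n] has singleton
     fibers. *)
  apply: eq_bigr => j _; rewrite (@fiber_sum_eq _ _ _ _ _ unit _ (fun=> tt)) //.
    by rewrite (big_pred1 tt) // => -[].
rewrite exchange_big; apply: eq_bigr => j _ /=.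
rewrite (@fiber_sum_eq _ _ _ _ _ _ _ id) //.
  by apply: eq_bigr => K _; rewrite big_pred1_eq.
move=> K K'; split=> [/seq_prefix_eqP h|-> //]; apply/ffunP => l; exact: h.
Qed.

End Functional.
End Telescope.

(** * Decoding one letter, and its fidelity *)

Section Decoding.
Variable R : realType.
Local Notation C := R[i].

(** Each summand relabels basis vectors, so complete positivity is [psd_relabel] on the enlarged
    index set. Partial traces controlled by a label have this form. *)
Lemma cptp_select (S T Z : finType) (P : pred Z) (h : Z -> T -> S) :
  (forall X : op R S, \sum_a \sum_(z | P z) ent X (h z a) (h z a) = \tr X) ->
  cptp (fun X : op R S => mkop (fun a b : T => \sum_(z | P z) ent X (h z a) (h z b))).
Proof.
move=> tp; split.
- move=> a A B; apply/op_eqP => x y; rewrite entD entZ !ent_mkop mulr_sumr -big_split.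
  by apply: eq_bigr => z _; rewrite entD entZ.
- move=> m X pX.
  have := psd_sum (P := P) (fun z _ => psd_relabel (fun x : 'I_m * T => (x.1, h z x.2)) pX).
  congr psd; apply/op_eqP => x y; rewrite ent_sum !ent_mkop.
  by apply: eq_bigr => z _; rewrite !ent_mkop.
- by move=> X; rewrite tr_ent -tp; apply: eq_bigr => a _; rewrite ent_mkop.
Qed.

Lemma fid_sum (T X : finType) (P : pred X) (psi : T -> C) (A : X -> op R T) :
  fid psi (\sum_(x | P x) A x) = \sum_(x | P x) fid psi (A x).
Proof. by rewrite /fid mulmx_sumr (raddf_sum (@mxtrace _ _)) Re_sum. Qed.

Lemma fidZ (T : finType) (psi : T -> C) c (A : op R T) :
  fid psi (toC c *: A) = c * fid psi A.
Proof. by rewrite /fid -scalemxAr mxtraceZ Re_toCM. Qed.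

Section PtrExcept.
Variables (n : nat) (T : finType).

Lemma ptr_except_upd (k : 'I_n) a0 (A : op R {ffun 'I_n -> T}) a b :
  ent (ptr_except k A) a b =
  \sum_(f : {ffun 'I_n -> T} | f k == a0) ent A (upd f k a) (upd f k b).
Proof.
rewrite ent_mkop -(sum_upd k a a0 (fun x => ent A x (upd x k b))).
by apply: eq_bigr => f _; rewrite upd_upd.
Qed.

Lemma ptr_exceptZ (k : 'I_n) c (A : op R {ffun 'I_n -> T}) :
  ptr_except k (c *: A) = c *: ptr_except k A.
Proof.
apply/op_eqP => a b; rewrite entZ !ent_mkop mulr_sumr.
by apply: eq_bigr => f _; rewrite entZ.
Qed.

Lemma ptr_except_sum (k : 'I_n) (X : finType) (P : pred X) (A : X -> op R {ffun 'I_n -> T}) :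
  ptr_except k (\sum_(x | P x) A x) = \sum_(x | P x) ptr_except k (A x).
Proof.
apply/op_eqP => a b; rewrite ent_sum ent_mkop.
under eq_bigr do rewrite ent_sum.
by rewrite exchange_big; apply: eq_bigr => x _; rewrite ent_mkop.
Qed.

End PtrExcept.

Lemma ptr2_flag (F L : finType) (M : L -> op R F) : ptr2 (flag M) = \sum_l M l.
Proof.
apply/op_eqP => a b; rewrite ent_sum ent_mkop; apply: eq_bigr => l _.
by rewrite ent_mkop eqxx mul1r.
Qed.

(** Discarding the classical register undoes the erasure, as the label is always in the quantum
    register; decoding is therefore unaffected by [q]. *)
Lemma erased_sum_flag (I F L : finType) (B : I -> L -> op R F) (q : R) i :
  \sum_c erased B q i c = flag (B i).
Proof.
rewrite sum_option /= -scaler_sumr.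
have -> : \sum_l flag (single l (B i l)) = flag (B i).
  apply/op_eqP => x y; rewrite ent_sum ent_mkop (bigD1 x.2) //= big1 ?addr0.
    by rewrite ent_mkop /single eqxx scale1r.
  by move=> l /negbTE lx; rewrite ent_mkop /single lx scale0r ent0 mulr0.
by rewrite -scalerDl -rmorphD subrK rmorph1 scale1r.
Qed.

Section LetterDecoder.
Variables (n d : nat) (I J : finType) (p : I -> R).
Hypothesis n0 : (0 < n)%N.
Hypothesis p0 : forall i, 0 <= p i.
Hypothesis p1 : \sum_i p i = 1.
Local Notation F := {ffun 'I_n -> 'I_d}.
Variable M : {ffun 'I_n -> I} -> J -> op R F.
Hypothesis pM : forall K j, psd (M K j).
Hypothesis trM : forall K, \sum_j \tr (M K j) = 1.
Variables (b0 : F * label n I J) (a0 : 'I_d) (q : R).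
Hypothesis q01 : 0 <= q <= 1.

Local Notation B := (letter_family p M).
Local Notation L := (label n I J).
Local Notation E := (family_encoding b0 (erased B q)).

Let position (z : option L * L * F) : 'I_n := z.1.2.1.1.

Let embed (z : option L * L * F) (a : 'I_d) : 'I_#|{: F * L}| * 'I_#|{: option L}| :=
  (enum_rank (upd z.2 (position z) a, z.1.2), enum_rank z.1.1).

(** Reads the position in the label kept with the quantum system, keeps the letter found there and
    traces out everything else. The basis index [a0] is the dummy of [sum_upd]. *)
Definition letter_decoder (X : op R ('I_#|{: F * L}| * 'I_#|{: option L}|)%type) : op R 'I_d :=
  mkop (fun a b => \sum_(z : option L * L * F | z.2 (position z) == a0)
    ent X (embed z a) (embed z b)).

Let sum_select (V : nmodType) (G : option L * L * F -> V) :
  \sum_(z : option L * L * F | z.2 (position z) == a0) G z =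
  \sum_c \sum_l \sum_(f : F | f l.1.1 == a0) G (c, l, f).
Proof.
rewrite big_mkcond sum_pair sum_pair; apply: eq_bigr => c _; apply: eq_bigr => l _.
by rewrite [RHS]big_mkcond.
Qed.

Lemma letter_decoder_cptp : cptp letter_decoder.
Proof.
apply: cptp_select => X.
rewrite tr_ent [RHS]sum_pair [RHS]exchange_big.
rewrite [RHS](sum_enum_val (fun c => \sum_x ent X (x, c) (x, c))).
under eq_bigr do rewrite sum_select.
rewrite exchange_big; apply: eq_bigr => c _ /=.
rewrite exchange_big [RHS](sum_enum_val (fun x => ent X (x, enum_rank c) (x, enum_rank c))).
rewrite [RHS]sum_pair [RHS]exchange_big /=; apply: eq_bigr => l _.
exact: (sum_upd_all l.1.1 a0
  (fun f => ent X (enum_rank (f, l), enum_rank c) (enum_rank (f, l), enum_rank c))).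
Qed.

Lemma letter_decoderE i :
  letter_decoder (enc_state E i) = \sum_l ptr_except l.1.1 (B i l).
Proof.
have pE := erased_psd (letter_psd p0 pM) q01.
apply/op_eqP => a b; rewrite ent_mkop ent_sum sum_select exchange_big.
apply: eq_bigr => l _; rewrite (ptr_except_upd _ a0) exchange_big; apply: eq_bigr => f _ /=.
under eq_bigr do rewrite enc_stateE // /embed /position /= eqxx mul1r !enum_rankK /=.
by rewrite -ent_sum erased_sum_flag ent_mkop eqxx mul1r.
Qed.

(** The uniform position in the label produces the average over [k], and [letter_scaled] restores
    the law of the original sequence. *)
Lemma letter_decoder_fid (phi : I -> 'I_d -> C) :
  \sum_i p i * fid (phi i) (letter_decoder (enc_state E i)) =
  \sum_K prob_seq p K * (n%:R^-1 * \sum_(k < n)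
     fid (phi (K k)) (ptr_except k (ptr2 (flag (M K))))).
Proof.
have e i : p i * fid (phi i) (letter_decoder (enc_state E i)) = \sum_(k < n)
    \sum_(K : {ffun 'I_n -> I} | K k == i) n%:R^-1 * prob_seq p K *
      fid (phi (K k)) (ptr_except k (ptr2 (flag (M K)))).
  rewrite letter_decoderE -fidZ scaler_sumr.
  under eq_bigr do rewrite -ptr_exceptZ letter_scaled //.
  rewrite fid_sum sum_label; apply: eq_bigr => k _; rewrite exchange_big /=.
  transitivity (\sum_j \sum_(K : {ffun 'I_n -> I} | K k == i)
     n%:R^-1 * prob_seq p K * fid (phi i) (ptr_except k (M K j))).
    apply: eq_bigr => j _; rewrite [RHS](partition_big (seq_prefix k) predT) //=.
    apply: eq_bigr => g _; rewrite ptr_exceptZ fidZ ptr_except_sum fid_sum mulr_sumr.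
    apply: eq_big => [K|K _]; first by rewrite andbC.
    by rewrite ptr_exceptZ fidZ mulrA.
  rewrite exchange_big; apply: eq_bigr => K /eqP -> /=.
  by rewrite ptr2_flag ptr_except_sum fid_sum mulr_sumr.
rewrite (eq_bigr _ (fun i _ => e i)) exchange_big /=.
transitivity (\sum_(k < n) \sum_(K : {ffun 'I_n -> I}) n%:R^-1 * prob_seq p K *
    fid (phi (K k)) (ptr_except k (ptr2 (flag (M K))))).
  apply: eq_bigr => k _.
  by rewrite [RHS](partition_big (fun K : {ffun 'I_n -> I} => K k) predT).
rewrite exchange_big; apply: eq_bigr => K _ /=.
rewrite !mulr_sumr; apply: eq_bigr => k _; rewrite !mulrA; congr (_ * _); exact: mulrC.
Qed.

End LetterDecoder.
End Decoding.

(** * Holevo quantities and the assembly of the bounds *)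

Section Holevo.
Variable R : realType.
Local Notation C := R[i].

(** Moves the probabilities into the operators, the form in which monotonicity and the telescope are
    proved. *)
Lemma holevo_weighted (X T : finType) (s : X -> R) (rho : X -> op R T) :
  (forall x, 0 <= s x) -> (forall x, density (rho x)) ->
  holevo s rho = vN_entropy (\sum_x toC (s x) *: rho x)
    - \sum_x vN_entropy (toC (s x) *: rho x) + \sum_x eta (s x).
Proof.
move=> s0 drho; rewrite /holevo.
have e x : vN_entropy (toC (s x) *: rho x) = s x * vN_entropy (rho x) + eta (s x).
  by have [pr tr] := drho x; rewrite entropyZ // tr mulr1.
rewrite (eq_bigr _ (fun x _ => e x)) big_split /=; ring.
Qed.

Section ProductStates.
Variables (I : finType) (d n : nat) (p : I -> R) (phi : I -> 'I_d -> C).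
Hypothesis p0 : forall i, 0 <= p i.
Hypothesis p1 : \sum_i p i = 1.
Hypothesis uphi : forall i, unit_ket (phi i).

Lemma tr_ket_proj (T : finType) (psi : T -> C) : unit_ket psi -> \tr (ket_proj psi) = 1.
Proof.
by move=> /sqnorm_unit <-; rewrite tr_ent; apply: eq_bigr => x _; rewrite ent_mkop.
Qed.

Lemma prod_ket_unit (K : {ffun 'I_n -> I}) :
  unit_ket (fun x : {ffun 'I_n -> 'I_d} => \prod_k phi (K k) (x k)).
Proof.
rewrite /unit_ket; under eq_bigr do rewrite normr_prod -prodrXl.
rewrite -(bigA_distr_bigA (fun k t => `|phi (K k) t| ^+ 2)) /=.
by rewrite big1 // => k _; apply: uphi.
Qed.

Lemma prod_state_density (K : {ffun 'I_n -> I}) : density (prod_state phi K).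
Proof. by split; [exact: psd_ket_proj | apply/tr_ket_proj/prod_ket_unit]. Qed.

Lemma entropy_ens_power :
  vN_entropy (\sum_(K : {ffun 'I_n -> I}) toC (prob_seq p K) *: prod_state phi K)
  = n%:R * ens_entropy p phi.
Proof.
apply: entropy_tensor_power.
- by apply: psd_sum => i _; apply: psdZ => //; apply: psd_ket_proj.
- rewrite (raddf_sum (@mxtrace _ _)) /=.
  under eq_bigr do rewrite mxtraceZ tr_ket_proj // mulr1.
  by rewrite -rmorph_sum p1 rmorph1.
move=> x y; rewrite ent_sum.
under [RHS]eq_bigr do rewrite ent_sum.
rewrite bigA_distr_bigA; apply: eq_bigr => K _.
rewrite entZ ent_mkop rmorph_prod (rmorph_prod Num.conj) -!big_split /=.
by apply: eq_bigr => k _; rewrite entZ ent_mkop.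
Qed.

(** Before the channel the states are pure, so their Holevo quantity is the entropy of the average,
    a tensor power. *)
Lemma holevo_cptp_le (T : finType) (Phi : op R {ffun 'I_n -> 'I_d} -> op R T) :
  cptp Phi ->
  holevo (fun K => prob_seq p K) (fun K => Phi (prod_state phi K)) <= n%:R * ens_entropy p phi.
Proof.
move=> cPhi; have [lin _ tp] := cPhi.
have P0 (K : {ffun 'I_n -> I}) : 0 <= prob_seq p K by apply: prob_seq_ge0.
rewrite holevo_weighted //; last first.
  move=> K; have [pK tK] := prod_state_density K.
  by split; [apply: cptp_psd | rewrite tp].
have pA (K : {ffun 'I_n -> I}) : psd (toC (prob_seq p K) *: prod_state phi K).
  by apply: psdZ => //; apply: psd_ket_proj.
have := holevo_monotone cPhi pA.
under eq_bigr do rewrite linear_mapZ //.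
under [X in _ - X <= _]eq_bigr do rewrite linear_mapZ //.
rewrite entropy_ens_power.
have -> : \sum_(K : {ffun 'I_n -> I}) vN_entropy (toC (prob_seq p K) *: prod_state phi K)
    = \sum_(K : {ffun 'I_n -> I}) eta (prob_seq p K).
  apply: eq_bigr => K _; have [pK tK] := prod_state_density K.
  by rewrite entropyZ // tK entropy_ket_proj ?mulr0 ?add0r ?mulr1 //; apply: prod_ket_unit.
by rewrite lerBrDr.
Qed.

End ProductStates.

(** Normalization supplies the default letter, basis vector and outcome required by the encoding and
    the decoder. *)
Lemma sum1_inhabited (T : finType) (V : nzRingType) (f : T -> V) :
  \sum_x f x = 1 -> exists x : T, True.
Proof.
move=> f1; have [x _|e] := pickP (fun _ : T => true); first by exists x.
by move: f1; rewrite big_pred0 // => /esym/eqP; rewrite oner_eq0.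
Qed.

Section LetterEncoding.
Variables (I : finType) (d n c : nat) (p : I -> R) (phi : I -> 'I_d -> C).
Hypothesis p0 : forall i, 0 <= p i.
Hypothesis p1 : \sum_i p i = 1.
Hypothesis uphi : forall i, unit_ket (phi i).
Hypothesis n0 : (0 < n)%N.
Variables (pj : {ffun 'I_n -> I} -> 'I_c -> R)
  (phit : {ffun 'I_n -> I} -> 'I_c -> op R {ffun 'I_n -> 'I_d}).
Hypothesis pj0 : forall K j, 0 <= pj K j.
Hypothesis pj1 : forall K, \sum_j pj K j = 1.
Hypothesis dphit : forall K j, density (phit K j).

Definition outcome (K : {ffun 'I_n -> I}) (j : 'I_c) : op R {ffun 'I_n -> 'I_d} :=
  toC (pj K j) *: phit K j.

Lemma outcome_psd K j : psd (outcome K j).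
Proof. by have [pp _] := dphit K j; apply: psdZ. Qed.

Lemma outcome_trE K j : \tr (outcome K j) = toC (pj K j).
Proof. by have [_ tt] := dphit K j; rewrite mxtraceZ tt mulr1. Qed.

Lemma outcome_tr K : \sum_j \tr (outcome K j) = 1.
Proof.
by under eq_bigr do rewrite outcome_trE; rewrite -rmorph_sum pj1 rmorph1.
Qed.

Lemma outcome_flag K :
  \sum_j toC (pj K j) *: tens (phit K j) (ket_proj (basis_ket j)) = flag (outcome K).
Proof.
apply/op_eqP => x y; rewrite ent_sum ent_mkop entZ.
under eq_bigr => j _.
  rewrite entZ ent_mkop ent_mkop /basis_ket conjC_nat mulrA mulrCA.
  over.
rewrite (sum_delta x.2 (fun j => toC (pj K j) * ent (phit K j) x.1 y.1 * (y.2 == j)%:R)).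
by rewrite eq_sym mulrC.
Qed.

Local Notation B := (letter_family p outcome).

(** The telescope for the von Neumann entropy, where the Shannon entropy of the sequence is [n]
    times that of a letter. *)
Lemma letter_holevo :
  holevo (fun K => prob_seq p K) (fun K => flag (outcome K)) =
  n%:R * (\sum_i eta (p i) + \sum_l vN_entropy (\sum_i toC (p i) *: B i l)
    - \sum_i \sum_l vN_entropy (toC (p i) *: B i l)).
Proof.
have P0 (K : {ffun 'I_n -> I}) : 0 <= prob_seq p K by apply: prob_seq_ge0.
have pM := outcome_psd; have trM := outcome_tr.
rewrite holevo_weighted //; last first.
  move=> K; have [pf _] := flag_entropy (pM K); split=> //.
  by rewrite tr_flag trM.
rewrite -[in RHS]addrA [in RHS]mulrDr.
rewrite (letter_telescope n0 p0 p1 pM trM (Phi := @vN_entropy R #|{ffun 'I_n -> 'I_d}|)) //;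
  last 2 first.
- exact: vN_entropy0.
- by move=> a A a0 pA; exact: entropyZ.
rewrite -sum_eta_prod // [LHS]addrC; congr (_ + (_ - _)).
  under eq_bigr do rewrite -flagZ.
  rewrite -flag_sum; have [] // := flag_entropy (M := fun j => \sum_K weighted p outcome K j).
  by move=> j; apply: psd_sum => K _; apply: weighted_psd.
apply: eq_bigr => K _; rewrite -flagZ.
have [] // := flag_entropy (M := weighted p outcome K).
by move=> j; apply: weighted_psd.
Qed.

(** The same telescope for [eta] of the trace. *)
Lemma letter_mutual_info :
  mutual_info (fun x : {ffun 'I_n -> I} * 'I_c => prob_seq p x.1 * pj x.1 x.2) =
  n%:R * (\sum_i eta (p i) + \sum_l eta (\sum_i joint p B i l)
    - \sum_i \sum_l eta (joint p B i l)).
Proof.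
have pM := outcome_psd; have trM := outcome_tr.
pose Phi (A : op R {ffun 'I_n -> 'I_d}) := eta (complex.Re (\tr A)).
have jE i l : eta (joint p B i l) = Phi (toC (p i) *: B i l).
  by rewrite /Phi mxtraceZ Re_toCM.
have jsE l : eta (\sum_i joint p B i l) = Phi (\sum_i toC (p i) *: B i l).
  rewrite /Phi (raddf_sum (@mxtrace _ _)) Re_sum; congr Defs.eta; apply: eq_bigr => i _.
  by rewrite /= mxtraceZ Re_toCM.
under [X in _ = _ * (_ + X - _)]eq_bigr do rewrite jsE.
under [X in _ = _ * (_ - X)]eq_bigr do under eq_bigr do rewrite jE.
rewrite -[in RHS]addrA [in RHS]mulrDr.
rewrite (letter_telescope n0 p0 p1 pM trM (Phi := Phi)) //; last 2 first.
- by rewrite /Phi mxtrace0 eta0.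
- move=> a A a0 pA; rewrite /Phi mxtraceZ Re_toCM etaM //.
  exact/Re_ge0/psd_tr_ge0.
have wE K j : complex.Re (\tr (weighted p outcome K j)) = prob_seq p K * pj K j.
  by rewrite mxtraceZ outcome_trE Re_toCM.
rewrite -sum_eta_prod // /mutual_info -addrA; congr (_ + (_ - _)).
- by apply: eq_bigr => K _ /=; rewrite -mulr_sumr pj1 mulr1.
- apply: eq_bigr => j _ /=; rewrite /Phi (raddf_sum (@mxtrace _ _)) Re_sum.
  by congr Defs.eta; apply: eq_bigr => K _; rewrite /= wE.
- rewrite /shannon sum_pair; apply: eq_bigr => K _; apply: eq_bigr => j _ /=.
  by rewrite /Phi wE.
Qed.

Lemma X_eps_le (rate eps : R) : 0 <= rate ->
  n%:R * rate <= mutual_info (fun x : {ffun 'I_n -> I} * 'I_c => prob_seq p x.1 * pj x.1 x.2) ->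
  1 - eps <= \sum_K prob_seq p K * (n%:R^-1 * \sum_(k < n)
     fid (phi (K k)) (ptr_except k (ptr2 (flag (outcome K))))) ->
  (X_eps p phi eps rate <=
    (n%:R^-1 * holevo (fun K => prob_seq p K) (fun K => flag (outcome K)))%:E)%E.
Proof.
move=> rate0; rewrite letter_mutual_info letter_holevo => h1 h2.
have nR : 0 < n%:R :> R by rewrite ltr0n.
rewrite ler_pM2l // in h1; rewrite mulrA mulVf ?gt_eqF // mul1r.
(* [R'] and [chi] are the classical and the total information of the letter encoding before
   erasure. *)
set R' := _ - _ in h1; set chi := _ - _.
have [i0 _] := sum1_inhabited p1.
have [a0 _] := sum1_inhabited (uphi i0).
have [j0 _] := sum1_inhabited (pj1 [ffun=> i0]).
pose b0 : {ffun 'I_n -> 'I_d} * label n I 'I_c :=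
  ([ffun=> a0], (Ordinal n0, [ffun=> None], j0)).
(* Chosen so that [erased_classical] brings [R'] down to exactly [rate]. If [R' = 0], then
   [rate = 0] as well and [q] is [0] by the convention on division. *)
pose q := rate / R'.
have q01 : 0 <= q <= 1.
  have R0 : 0 <= R' by apply: le_trans h1.
  rewrite /q divr_ge0 //=; have [->|Rn] := eqVneq R' 0; first by rewrite invr0 mulr0 ler01.
  by rewrite ler_pdivrMr ?mul1r // lt0r Rn.
have qR : q * R' = rate.
  rewrite /q; have [R0|Rn] := eqVneq R' 0; last by rewrite divfK.
  by rewrite R0 mulr0; apply/le_anti; rewrite rate0 -R0 h1.
have pM := outcome_psd; have trM := outcome_tr.
have pB := letter_psd p0 pM; have trB := letter_tr n0 p1 trM.
have pE := erased_psd pB q01; have trE i : \sum_c \tr (erased B q i c) = 1 by apply: erased_tr.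
pose E := family_encoding b0 (erased B q).
have sac : SAC p E = rate by rewrite family_SAC // erased_classical //; exact: qR.
have sabgc : SABgC p E = chi - rate.
  rewrite family_SABgC // sac; congr (_ - _).
  by rewrite /chi -[LHS]addrA -[RHS]addrA erased_total.
(* The encoding [E] is a competitor in the infimum with value [chi - rate], and the added [rate]
   restores [chi]. *)
rewrite /X_eps -[chi](subrKC rate) -sabgc EFinD leeD2l //.
apply: ereal_inf_lbound; exists E => //; split.
- exact: family_encoding_valid.
- by rewrite sac.
- exists (letter_decoder a0); split; first exact: letter_decoder_cptp.
  by rewrite letter_decoder_fid.
Qed.

End LetterEncoding.
End Holevo.

Unset Implicit Arguments.

Theorem theorem7p1 (R : realType) (I : finType) (d : nat)
  (p : I -> R) (phi : I -> 'I_d -> R[i])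
  (hp0 : forall i, 0 <= p i) (hp1 : \sum_i p i = 1)
  (hphi : forall i, unit_ket (phi i))
  (n : nat) (rate eps : R)
  (hn : (1 <= n)%N) (hrate : 0 <= rate) (heps : 0 < eps)
  (c : nat)
  (Gamma : op R {ffun 'I_n -> 'I_d} -> op R ({ffun 'I_n -> 'I_d} * 'I_c)%type)
  (hGamma : cptp Gamma)
  (pj : {ffun 'I_n -> I} -> 'I_c -> R)
  (phit : {ffun 'I_n -> I} -> 'I_c -> op R {ffun 'I_n -> 'I_d})
  (hpj0 : forall II j, 0 <= pj II j)
  (hpj1 : forall II, \sum_j pj II j = 1)
  (hphit : forall II j, density (phit II j))
  (hclass : forall II, Gamma (prod_state phi II)
            = \sum_j toC (pj II j) *: tens (phit II j) (ket_proj (basis_ket j)))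
  (h1 : n%:R * rate <=
        mutual_info (fun x : {ffun 'I_n -> I} * 'I_c => prob_seq p x.1 * pj x.1 x.2))
  (h2 : 1 - eps <=
        \sum_II prob_seq p II *
          (n%:R^-1 * \sum_(k < n)
             fid (phi (II k)) (ptr_except k (ptr2 (Gamma (prod_state phi II)))))) :
  (X_eps p phi eps rate <= (ens_entropy p phi)%:E)%E /\
  (n%:R%:E * X_eps p phi eps rate
     <= (holevo (fun II => prob_seq p II) (fun II => Gamma (prod_state phi II)))%:E)%E.
Proof.
have nR : 0 < n%:R :> R by rewrite ltr0n.
have GE K : Gamma (prod_state phi K) = flag (outcome pj phit K).
  by rewrite hclass outcome_flag.
have h2' : 1 - eps <= \sum_K prob_seq p K * (n%:R^-1 * \sum_(k < n)
    fid (phi (K k)) (ptr_except k (ptr2 (flag (outcome pj phit K))))).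
  apply: (le_trans h2); apply: ler_sum => K _.
  by under eq_bigr do rewrite GE.
have chiE : holevo (fun II => prob_seq p II) (fun II => Gamma (prod_state phi II)) =
    holevo (fun K => prob_seq p K) (fun K => flag (outcome pj phit K)).
  by congr holevo; apply/funext => K.
have Xle := X_eps_le hp0 hp1 hphi hn hpj0 hpj1 hphit hrate h1 h2'.
have chi_le := holevo_cptp_le hp0 hp1 hphi hGamma.
rewrite chiE in chi_le *; split.
  by apply: (le_trans Xle); rewrite lee_fin ler_pdivrMl.
apply: le_trans (lee_wpmul2l _ Xle) _; first by rewrite lee_fin ltW.
by rewrite -EFinM mulrA mulfV ?gt_eqF // mul1r.
Qed.
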